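(* Let $A$ be a $*$-algebra, let $(\Omega^\bullet A,d,* )$ be a differential $*$-calculus on $A$, and let $J$ be an integrable almost complex structure on it. Then $d=\partial+\bar\partial$ on $\Omega^\bullet A$, and $$\partial^2=0,\qquad \partial\bar\partial+\bar\partial\partial=0,\qquad \bar\partial^2=0 .$$
   Context: All algebras are associative, unital, over $\mathbb{C}$, not necessarily commutative. A $*$-algebra is an algebra $A$ with a conjugate-linear map $a\mapsto a^*$ such that $a^{**}=a$ and $(ab)^*=b^*a^*$. The universal differential graded algebra of $A$ is the tensor algebra $\Omega^\bullet_{\rm univ}A=T_A(\Omega^1_{\rm univ}A)$, where $\Omega^1_{\rm univ}A=\ker(A\otimes A\to A)$ (kernel of multiplication), with the unique degree one superderivation $d$ ($d^2=0$) such that $da=1\otimes a-a\otimes 1$ for $a\in A$. A differential calculus on $A$ is a differential graded algebra $(\Omega^\bullet A,d)$ that is a quotient of $(\Omega^\bullet_{\rm univ}A,d)$ by a differential graded ideal whose degree-zero component is zero; so $\Omega^0A=A$ and $\Omega^nA$ is spanned by the elements $a_0\,da_1\wedge\cdots\wedge da_n$. The product is written $\wedge$ and is not assumed graded-commutative. A differential $*$-calculus $(\Omega^\bullet A,d,* )$ on a $*$-algebra $A$ is a differential calculus together with a conjugate-linear, grading-preserving involution $\xi\mapsto\xi^*$ on $\Omega^\bullet A$ extending $*$ on $A$, with $(d\xi)^*=d(\xi^* )$ and $(\xi\wedge\eta)^*=(-1)^{|\xi||\eta|}\eta^*\wedge\xi^*$ for homogeneous $\xi,\eta$. An almost complex structure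 on $(\Omega^\bullet A,d,* )$ is a degree zero $\mathbb{C}$-linear derivation $J:\Omega^\bullet A\to\Omega^\bullet A$ (so $J(\xi\wedge\eta)=J\xi\wedge\eta+\xi\wedge J\eta$) such that $J=0$ on $A$, $J^2=-1$ on $\Omega^1A$, and $J(\xi^* )=(J\xi)^*$ for $\xi\in\Omega^1A$. For $p,q\ge 0$ put $\Omega^{p,q}A=\{\xi\in\Omega^{p+q}A: J\xi=(p-q)\mathrm{i}\,\xi\}$; then $\Omega^nA=\bigoplus_{p+q=n}\Omega^{p,q}A$ as $A$-bimodules, with projections $\pi^{p,q}:\Omega^{p+q}A\to\Omega^{p,q}A$. Define $\partial=\pi^{p+1,q}d:\Omega^{p,q}A\to\Omega^{p+1,q}A$ and $\bar\partial=\pi^{p,q+1}d:\Omega^{p,q}A\to\Omega^{p,q+1}A$, extended additively to $\Omega^\bullet A$. $J$ is integrable if $d\,\Omega^{1,0}A\subset\Omega^{2,0}A\oplus\Omega^{1,1}A$. *)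

(* Defs.v *)
From HB Require Import structures.
From mathcomp Require Import all_boot all_order all_algebra.
From mathcomp Require Import boolp classical_sets reals.
From mathcomp Require Import complex.

Set Implicit Arguments.
Unset Strict Implicit.
Unset Printing Implicit Defensive.

Import GRing.Theory.
Local Open Scope ring_scope.
Local Open Scope classical_set_scope.
Local Open Scope quotient_scope.

(* Algebras are MathComp's algType, which are nonzero (1 != 0). *)

(* The tensor product over K: formal combinations of pure tensors modulo the
   congruence generated by the module axioms and bilinearity. *)
Section TensorProduct.
Variables (K : comNzRingType) (V W : lmodType K).

Inductive tensor_term :=
  | TPure of V & W
  | TAdd of tensor_term & tensor_term
  | TScale of K & tensor_term.

Inductive tensor_eq : tensor_term -> tensor_term -> Prop :=
  | teq_refl t : tensor_eq t t
  | teq_sym s t : tensor_eq s t -> tensor_eq t s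
  | teq_trans t s u : tensor_eq s t -> tensor_eq t u -> tensor_eq s u
  | teq_add s s' t t' : tensor_eq s s' -> tensor_eq t t' ->
      tensor_eq (TAdd s t) (TAdd s' t')
  | teq_scale c t t' : tensor_eq t t' -> tensor_eq (TScale c t) (TScale c t')
  | teq_addA s t u : tensor_eq (TAdd s (TAdd t u)) (TAdd (TAdd s t) u)
  | teq_addC s t : tensor_eq (TAdd s t) (TAdd t s)
  | teq_add0 t : tensor_eq (TAdd (TPure 0 0) t) t
  | teq_addN t : tensor_eq (TAdd (TScale (-1) t) t) (TPure 0 0)
  | teq_scaleA a b t : tensor_eq (TScale a (TScale b t)) (TScale (a * b) t)
  | teq_scale1 t : tensor_eq (TScale 1 t) t
  | teq_scaleDr c s t :
      tensor_eq (TScale c (TAdd s t)) (TAdd (TScale c s) (TScale c t))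
  | teq_scaleDl a b t :
      tensor_eq (TScale (a + b) t) (TAdd (TScale a t) (TScale b t))
  | teq_pureDl v v' w :
      tensor_eq (TPure (v + v') w) (TAdd (TPure v w) (TPure v' w))
  | teq_pureDr v w w' :
      tensor_eq (TPure v (w + w')) (TAdd (TPure v w) (TPure v w'))
  | teq_pureZl c v w : tensor_eq (TPure (c *: v) w) (TScale c (TPure v w))
  | teq_pureZr c v w : tensor_eq (TPure v (c *: w)) (TScale c (TPure v w)).

HB.instance Definition _ := gen_eqMixin tensor_term.
HB.instance Definition _ := gen_choiceMixin tensor_term.

Definition tensor_eqb : rel tensor_term := fun s t => `[< tensor_eq s t >].

Lemma tensor_eqb_refl : reflexive tensor_eqb.
Proof. by move=> t; apply/asboolP; exact: teq_refl. Qed.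
Lemma tensor_eqb_sym : symmetric tensor_eqb.
Proof. by move=> s t; apply/asboolP/asboolP; exact: teq_sym. Qed.
Lemma tensor_eqb_trans : transitive tensor_eqb.
Proof.
by move=> t s u /asboolP st /asboolP tu; apply/asboolP; exact: teq_trans tu.
Qed.

Canonical tensor_equiv :=
  EquivRel tensor_eqb tensor_eqb_refl tensor_eqb_sym tensor_eqb_trans.

Definition tensor := {eq_quot tensor_equiv}.
HB.instance Definition _ := Choice.on tensor.
HB.instance Definition _ := EqQuotient.on tensor.

Definition tensor_class (t : tensor_term) : tensor := \pi_tensor t.

Lemma tensor_classP s t : tensor_class s = tensor_class t <-> tensor_eq s t.
Proof. by split=> [/eqmodP/asboolP|st]; last by apply/eqmodP/asboolP. Qed.

Lemma tensor_reprK t : tensor_class (repr t) = t.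
Proof. exact: reprK. Qed.

Lemma tensor_repr_eq t : tensor_eq (repr (tensor_class t)) t.
Proof. by apply/tensor_classP; rewrite tensor_reprK. Qed.

Definition tensor_add (x y : tensor) := tensor_class (TAdd (repr x) (repr y)).
Definition tensor_scale (c : K) (x : tensor) := tensor_class (TScale c (repr x)).

Lemma tensor_addE s t :
  tensor_add (tensor_class s) (tensor_class t) = tensor_class (TAdd s t).
Proof. by apply/tensor_classP/teq_add; exact: tensor_repr_eq. Qed.

Lemma tensor_scaleE c t :
  tensor_scale c (tensor_class t) = tensor_class (TScale c t).
Proof. by apply/tensor_classP/teq_scale; exact: tensor_repr_eq. Qed.

Lemma tensor_addA : associative tensor_add.
Proof.
move=> x y z; rewrite -(tensor_reprK x) -(tensor_reprK y) -(tensor_reprK z).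
by rewrite !tensor_addE; apply/tensor_classP/teq_addA.
Qed.

Lemma tensor_addC : commutative tensor_add.
Proof. by move=> x y; apply/tensor_classP/teq_addC. Qed.

Lemma tensor_add0 : left_id (tensor_class (TPure 0 0)) tensor_add.
Proof.
by move=> x; rewrite -(tensor_reprK x) tensor_addE; apply/tensor_classP/teq_add0.
Qed.

Lemma tensor_addN :
  left_inverse (tensor_class (TPure 0 0)) (tensor_scale (-1)) tensor_add.
Proof.
move=> x; rewrite -(tensor_reprK x) tensor_scaleE tensor_addE.
exact/tensor_classP/teq_addN.
Qed.

HB.instance Definition _ := GRing.isZmodule.Build tensor
  tensor_addA tensor_addC tensor_add0 tensor_addN.

Lemma tensor_scaleA a b x :
  tensor_scale a (tensor_scale b x) = tensor_scale (a * b) x.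
Proof.
by rewrite -(tensor_reprK x) !tensor_scaleE; apply/tensor_classP/teq_scaleA.
Qed.

Lemma tensor_scale1 : left_id 1 tensor_scale.
Proof.
by move=> x; rewrite -(tensor_reprK x) tensor_scaleE; apply/tensor_classP/teq_scale1.
Qed.

Lemma tensor_scaleDr : right_distributive tensor_scale +%R.
Proof.
move=> c x y; rewrite -(tensor_reprK x) -(tensor_reprK y).
rewrite [_ + _]tensor_addE !tensor_scaleE [RHS]tensor_addE.
exact/tensor_classP/teq_scaleDr.
Qed.

Lemma tensor_scaleDl x : {morph tensor_scale^~ x : a b / a + b >-> a + b}.
Proof.
move=> a b; rewrite -(tensor_reprK x) !tensor_scaleE [RHS]tensor_addE.
exact/tensor_classP/teq_scaleDl.
Qed.

HB.instance Definition _ := GRing.Zmodule_isLmodule.Build K tensor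
  tensor_scaleA tensor_scale1 tensor_scaleDr tensor_scaleDl.

Definition tens (v : V) (w : W) : tensor := tensor_class (TPure v w).

Lemma tensDl v v' w : tens (v + v') w = tens v w + tens v' w.
Proof. by rewrite [RHS]tensor_addE; apply/tensor_classP/teq_pureDl. Qed.
Lemma tensDr v w w' : tens v (w + w') = tens v w + tens v w'.
Proof. by rewrite [RHS]tensor_addE; apply/tensor_classP/teq_pureDr. Qed.
Lemma tensZl c v w : tens (c *: v) w = c *: tens v w.
Proof. by rewrite [RHS]tensor_scaleE; apply/tensor_classP/teq_pureZl. Qed.
Lemma tensZr c v w : tens v (c *: w) = c *: tens v w.
Proof. by rewrite [RHS]tensor_scaleE; apply/tensor_classP/teq_pureZr. Qed.

Lemma tensor_ind (P : tensor -> Prop) :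
  (forall v w, P (tens v w)) -> (forall x y, P x -> P y -> P (x + y)) ->
  (forall c x, P x -> P (c *: x)) -> forall x, P x.
Proof.
move=> Pp Pa Ps x; rewrite -(tensor_reprK x).
elim: (repr x) => [v w|s IHs t IHt|c t IHt]; first exact: Pp.
  by rewrite -tensor_addE; apply: Pa.
by rewrite -tensor_scaleE; apply: Ps.
Qed.

Section Lift.
Variables (X : lmodType K) (f : V -> W -> X).

Fixpoint tensor_eval (t : tensor_term) : X :=
  match t with
  | TPure v w => f v w
  | TAdd s t => tensor_eval s + tensor_eval t
  | TScale c t => c *: tensor_eval t
  end.

Definition tensor_lift (x : tensor) : X := tensor_eval (repr x).

Definition bilinear_map :=
  (forall w, linear (f^~ w)) /\ (forall v, linear (f v)).

Hypothesis bilf : bilinear_map.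

Lemma tensor_eval_eq s t : tensor_eq s t -> tensor_eval s = tensor_eval t.
Proof.
have [linl linr] := bilf.
have fDl v v' w : f (v + v') w = f v w + f v' w.
  by have := linl w 1 v v'; rewrite !scale1r.
have fDr v w w' : f v (w + w') = f v w + f v w'.
  by have := linr v 1 w w'; rewrite !scale1r.
have f0 w : f 0 w = 0.
  by apply: (@addrI _ (f 0 w)); rewrite -fDl !addr0.
have f0' v : f v 0 = 0.
  by apply: (@addrI _ (f v 0)); rewrite -fDr !addr0.
elim=> //= {s t}.
- by move=> t s u _ -> _ ->.
- by move=> s s' t t' _ -> _ ->.
- by move=> c t t' _ ->.
- by move=> s t u; rewrite addrA.
- by move=> s t; rewrite addrC.
- by move=> t; rewrite f0 add0r.
- by move=> t; rewrite scaleN1r addNr f0.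
- by move=> a b t; rewrite scalerA.
- by move=> t; rewrite scale1r.
- by move=> c s t; rewrite scalerDr.
- by move=> a b t; rewrite scalerDl.
- by move=> c v w; have := linl w c v 0; rewrite f0 !addr0.
- by move=> c v w; have := linr v c w 0; rewrite f0' !addr0.
Qed.

Lemma tensor_liftE t : tensor_lift (tensor_class t) = tensor_eval t.
Proof. exact/tensor_eval_eq/tensor_repr_eq. Qed.

Lemma tensor_lift_tens v w : tensor_lift (tens v w) = f v w.
Proof. exact: tensor_liftE. Qed.

Lemma tensor_lift_linear : linear tensor_lift.
Proof.
move=> c x y; rewrite -(tensor_reprK x) -(tensor_reprK y).
by rewrite [c *: _]tensor_scaleE [_ + _]tensor_addE !tensor_liftE.
Qed.

End Lift.
End TensorProduct.

(* The tensor algebra T_A(M) of a bimodule M, with actions [l] and [r]: the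
   associative algebra generated by the algebra A and the bimodule M. *)
Section TensorAlgebra.
Variables (K : comNzRingType) (A : algType K) (M : lmodType K).
Variables (l : A -> M -> M) (r : M -> A -> M).

Inductive talg_term :=
  | GBase of A
  | GVec of M
  | GAdd of talg_term & talg_term
  | GMul of talg_term & talg_term
  | GScale of K & talg_term.

Inductive talg_eq : talg_term -> talg_term -> Prop :=
  | geq_refl t : talg_eq t t
  | geq_sym s t : talg_eq s t -> talg_eq t s
  | geq_trans t s u : talg_eq s t -> talg_eq t u -> talg_eq s u
  | geq_add s s' t t' : talg_eq s s' -> talg_eq t t' ->
      talg_eq (GAdd s t) (GAdd s' t')
  | geq_mul s s' t t' : talg_eq s s' -> talg_eq t t' ->
      talg_eq (GMul s t) (GMul s' t')
  | geq_scale c t t' : talg_eq t t' -> talg_eq (GScale c t) (GScale c t')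
  | geq_addA s t u : talg_eq (GAdd s (GAdd t u)) (GAdd (GAdd s t) u)
  | geq_addC s t : talg_eq (GAdd s t) (GAdd t s)
  | geq_add0 t : talg_eq (GAdd (GBase 0) t) t
  | geq_addN t : talg_eq (GAdd (GScale (-1) t) t) (GBase 0)
  | geq_scaleA a b t : talg_eq (GScale a (GScale b t)) (GScale (a * b) t)
  | geq_scale1 t : talg_eq (GScale 1 t) t
  | geq_scaleDr c s t :
      talg_eq (GScale c (GAdd s t)) (GAdd (GScale c s) (GScale c t))
  | geq_scaleDl a b t :
      talg_eq (GScale (a + b) t) (GAdd (GScale a t) (GScale b t))
  | geq_mulA s t u : talg_eq (GMul s (GMul t u)) (GMul (GMul s t) u)
  | geq_mul1l t : talg_eq (GMul (GBase 1) t) t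
  | geq_mul1r t : talg_eq (GMul t (GBase 1)) t
  | geq_mulDl s t u : talg_eq (GMul (GAdd s t) u) (GAdd (GMul s u) (GMul t u))
  | geq_mulDr s t u : talg_eq (GMul s (GAdd t u)) (GAdd (GMul s t) (GMul s u))
  | geq_scaleAl c s t : talg_eq (GScale c (GMul s t)) (GMul (GScale c s) t)
  | geq_scaleAr c s t : talg_eq (GScale c (GMul s t)) (GMul s (GScale c t))
  | geq_baseD a b : talg_eq (GBase (a + b)) (GAdd (GBase a) (GBase b))
  | geq_baseM a b : talg_eq (GBase (a * b)) (GMul (GBase a) (GBase b))
  | geq_baseZ c a : talg_eq (GBase (c *: a)) (GScale c (GBase a))
  | geq_vecD m n : talg_eq (GVec (m + n)) (GAdd (GVec m) (GVec n))
  | geq_vecZ c m : talg_eq (GVec (c *: m)) (GScale c (GVec m))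
  | geq_vecl a m : talg_eq (GVec (l a m)) (GMul (GBase a) (GVec m))
  | geq_vecr m a : talg_eq (GVec (r m a)) (GMul (GVec m) (GBase a)).

HB.instance Definition _ := gen_eqMixin talg_term.
HB.instance Definition _ := gen_choiceMixin talg_term.

Definition talg_eqb : rel talg_term := fun s t => `[< talg_eq s t >].

Lemma talg_eqb_refl : reflexive talg_eqb.
Proof. by move=> t; apply/asboolP; exact: geq_refl. Qed.
Lemma talg_eqb_sym : symmetric talg_eqb.
Proof. by move=> s t; apply/asboolP/asboolP; exact: geq_sym. Qed.
Lemma talg_eqb_trans : transitive talg_eqb.
Proof.
by move=> t s u /asboolP st /asboolP tu; apply/asboolP; exact: geq_trans tu.
Qed.

Canonical talg_equiv :=
  EquivRel talg_eqb talg_eqb_refl talg_eqb_sym talg_eqb_trans.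

Definition tensor_alg := {eq_quot talg_equiv}.
HB.instance Definition _ := Choice.on tensor_alg.
HB.instance Definition _ := EqQuotient.on tensor_alg.

Definition talg_class (t : talg_term) : tensor_alg := \pi_tensor_alg t.

Lemma talg_classP s t : talg_class s = talg_class t <-> talg_eq s t.
Proof. by split=> [/eqmodP/asboolP|st]; last by apply/eqmodP/asboolP. Qed.

Lemma talg_reprK t : talg_class (repr t) = t.
Proof. exact: reprK. Qed.

Lemma talg_repr_eq t : talg_eq (repr (talg_class t)) t.
Proof. by apply/talg_classP; rewrite talg_reprK. Qed.

Definition talg_add (x y : tensor_alg) := talg_class (GAdd (repr x) (repr y)).
Definition talg_mul (x y : tensor_alg) := talg_class (GMul (repr x) (repr y)).
Definition talg_scale (c : K) (x : tensor_alg) := talg_class (GScale c (repr x)).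

Lemma talg_addE s t :
  talg_add (talg_class s) (talg_class t) = talg_class (GAdd s t).
Proof. by apply/talg_classP/geq_add; exact: talg_repr_eq. Qed.

Lemma talg_mulE s t :
  talg_mul (talg_class s) (talg_class t) = talg_class (GMul s t).
Proof. by apply/talg_classP/geq_mul; exact: talg_repr_eq. Qed.

Lemma talg_scaleE c t : talg_scale c (talg_class t) = talg_class (GScale c t).
Proof. by apply/talg_classP/geq_scale; exact: talg_repr_eq. Qed.

Lemma talg_addA : associative talg_add.
Proof.
move=> x y z; rewrite -(talg_reprK x) -(talg_reprK y) -(talg_reprK z).
by rewrite !talg_addE; apply/talg_classP/geq_addA.
Qed.

Lemma talg_addC : commutative talg_add.
Proof. by move=> x y; apply/talg_classP/geq_addC. Qed.

Lemma talg_add0 : left_id (talg_class (GBase 0)) talg_add.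
Proof.
by move=> x; rewrite -(talg_reprK x) talg_addE; apply/talg_classP/geq_add0.
Qed.

Lemma talg_addN :
  left_inverse (talg_class (GBase 0)) (talg_scale (-1)) talg_add.
Proof.
move=> x; rewrite -(talg_reprK x) talg_scaleE talg_addE.
exact/talg_classP/geq_addN.
Qed.

HB.instance Definition _ := GRing.isZmodule.Build tensor_alg
  talg_addA talg_addC talg_add0 talg_addN.

Lemma talg_scaleA a b x : talg_scale a (talg_scale b x) = talg_scale (a * b) x.
Proof.
by rewrite -(talg_reprK x) !talg_scaleE; apply/talg_classP/geq_scaleA.
Qed.

Lemma talg_scale1 : left_id 1 talg_scale.
Proof.
by move=> x; rewrite -(talg_reprK x) talg_scaleE; apply/talg_classP/geq_scale1.
Qed.

Lemma talg_scaleDr : right_distributive talg_scale +%R.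
Proof.
move=> c x y; rewrite -(talg_reprK x) -(talg_reprK y).
rewrite [_ + _]talg_addE !talg_scaleE [RHS]talg_addE.
exact/talg_classP/geq_scaleDr.
Qed.

Lemma talg_scaleDl x : {morph talg_scale^~ x : a b / a + b >-> a + b}.
Proof.
move=> a b; rewrite -(talg_reprK x) !talg_scaleE [RHS]talg_addE.
exact/talg_classP/geq_scaleDl.
Qed.

HB.instance Definition _ := GRing.Zmodule_isLmodule.Build K tensor_alg
  talg_scaleA talg_scale1 talg_scaleDr talg_scaleDl.

Lemma talg_mulA : associative talg_mul.
Proof.
move=> x y z; rewrite -(talg_reprK x) -(talg_reprK y) -(talg_reprK z).
by rewrite !talg_mulE; apply/talg_classP/geq_mulA.
Qed.

Lemma talg_mul1l : left_id (talg_class (GBase 1)) talg_mul.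
Proof.
by move=> x; rewrite -(talg_reprK x) talg_mulE; apply/talg_classP/geq_mul1l.
Qed.

Lemma talg_mul1r : right_id (talg_class (GBase 1)) talg_mul.
Proof.
by move=> x; rewrite -(talg_reprK x) talg_mulE; apply/talg_classP/geq_mul1r.
Qed.

Lemma talg_mulDl : left_distributive talg_mul +%R.
Proof.
move=> x y z; rewrite -(talg_reprK x) -(talg_reprK y) -(talg_reprK z).
rewrite [_ + _]talg_addE !talg_mulE [RHS]talg_addE.
exact/talg_classP/geq_mulDl.
Qed.

Lemma talg_mulDr : right_distributive talg_mul +%R.
Proof.
move=> x y z; rewrite -(talg_reprK x) -(talg_reprK y) -(talg_reprK z).
rewrite [_ + _]talg_addE !talg_mulE [RHS]talg_addE.
exact/talg_classP/geq_mulDr.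
Qed.

(* A tensor algebra retracts onto A, hence is nonzero. *)
Fixpoint talg_aug (t : talg_term) : A :=
  match t with
  | GBase a => a
  | GVec _ => 0
  | GAdd s t => talg_aug s + talg_aug t
  | GMul s t => talg_aug s * talg_aug t
  | GScale c t => c *: talg_aug t
  end.

Lemma talg_aug_eq s t : talg_eq s t -> talg_aug s = talg_aug t.
Proof.
elim=> //= {s t}.
- by move=> t s u _ -> _ ->.
- by move=> s s' t t' _ -> _ ->.
- by move=> s s' t t' _ -> _ ->.
- by move=> c t t' _ ->.
- by move=> s t u; rewrite addrA.
- by move=> s t; rewrite addrC.
- by move=> t; rewrite add0r.
- by move=> t; rewrite scaleN1r addNr.
- by move=> a b t; rewrite scalerA.
- by move=> t; rewrite scale1r.
- by move=> c s t; rewrite scalerDr.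
- by move=> a b t; rewrite scalerDl.
- by move=> s t u; rewrite mulrA.
- by move=> t; rewrite mul1r.
- by move=> t; rewrite mulr1.
- by move=> s t u; rewrite mulrDl.
- by move=> s t u; rewrite mulrDr.
- by move=> c s t; rewrite scalerAl.
- by move=> c s t; rewrite scalerAr.
- by move=> _ _; rewrite addr0.
- by move=> c _; rewrite scaler0.
- by move=> a _; rewrite mulr0.
- by move=> _ a; rewrite mul0r.
Qed.

Lemma talg_one_neq0 : talg_class (GBase 1) != 0 :> tensor_alg.
Proof.
apply/eqP => /talg_classP /talg_aug_eq /= /eqP.
by rewrite (negbTE (oner_neq0 A)).
Qed.

HB.instance Definition _ := GRing.Zmodule_isNzRing.Build tensor_alg
  talg_mulA talg_mul1l talg_mul1r talg_mulDl talg_mulDr talg_one_neq0.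

Lemma talg_scaleAl (c : K) (x y : tensor_alg) : c *: (x * y) = (c *: x) * y.
Proof.
rewrite -(talg_reprK x) -(talg_reprK y) [_ * _]talg_mulE [LHS]talg_scaleE.
rewrite [c *: _]talg_scaleE [RHS]talg_mulE.
exact/talg_classP/geq_scaleAl.
Qed.

Lemma talg_scaleAr (c : K) (x y : tensor_alg) : c *: (x * y) = x * (c *: y).
Proof.
rewrite -(talg_reprK x) -(talg_reprK y) [_ * _]talg_mulE [LHS]talg_scaleE.
rewrite [c *: _]talg_scaleE [RHS]talg_mulE.
exact/talg_classP/geq_scaleAr.
Qed.

HB.instance Definition _ := GRing.Lmodule_isLalgebra.Build K tensor_alg talg_scaleAl.
HB.instance Definition _ := GRing.Lalgebra_isAlgebra.Build K tensor_alg talg_scaleAr.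

Definition tbase (a : A) : tensor_alg := talg_class (GBase a).
Definition tvec (m : M) : tensor_alg := talg_class (GVec m).

Lemma tbaseD a b : tbase (a + b) = tbase a + tbase b.
Proof. by rewrite [RHS]talg_addE; apply/talg_classP/geq_baseD. Qed.
Lemma tbaseM a b : tbase (a * b) = tbase a * tbase b.
Proof. by rewrite [RHS]talg_mulE; apply/talg_classP/geq_baseM. Qed.
Lemma tbaseZ c a : tbase (c *: a) = c *: tbase a.
Proof. by rewrite [RHS]talg_scaleE; apply/talg_classP/geq_baseZ. Qed.
Lemma tvecD m n : tvec (m + n) = tvec m + tvec n.
Proof. by rewrite [RHS]talg_addE; apply/talg_classP/geq_vecD. Qed.
Lemma tvecZ c m : tvec (c *: m) = c *: tvec m.
Proof. by rewrite [RHS]talg_scaleE; apply/talg_classP/geq_vecZ. Qed.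
Lemma tvecl a m : tvec (l a m) = tbase a * tvec m.
Proof. by rewrite [RHS]talg_mulE; apply/talg_classP/geq_vecl. Qed.
Lemma tvecr m a : tvec (r m a) = tvec m * tbase a.
Proof. by rewrite [RHS]talg_mulE; apply/talg_classP/geq_vecr. Qed.

Lemma talg_ind (P : tensor_alg -> Prop) :
  (forall a, P (tbase a)) -> (forall m, P (tvec m)) ->
  (forall x y, P x -> P y -> P (x + y)) ->
  (forall x y, P x -> P y -> P (x * y)) ->
  (forall c x, P x -> P (c *: x)) -> forall x, P x.
Proof.
move=> Pb Pv Pa Pm Ps x; rewrite -(talg_reprK x).
elim: (repr x) => [a|m|s IHs t IHt|s IHs t IHt|c t IHt].
- exact: Pb.
- exact: Pv.
- by rewrite -talg_addE; apply: Pa.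
- by rewrite -talg_mulE; apply: Pm.
- by rewrite -talg_scaleE; apply: Ps.
Qed.

(* The n-th graded piece, spanned by the a m_1 ... m_n. *)
Definition tdeg (n : nat) : set tensor_alg :=
  [set x | exists s : seq (A * n.-tuple M),
     x = \sum_(p <- s) tbase p.1 * \prod_(m <- p.2) tvec m].

End TensorAlgebra.

(* A graded algebra is its total algebra W with homogeneous parts deg n; the
   wedge product is the product of W. *)
Section GradedAlgebra.
Variables (K : comNzRingType) (W : algType K).

Record is_grading (deg : nat -> set W) : Prop := {
  grading_lin : forall n (c : K) x y, deg n x -> deg n y -> deg n (c *: x + y);
  grading_0 : forall n, deg n 0;
  grading_1 : deg 0%N 1;
  grading_mul : forall m n x y, deg m x -> deg n y -> deg (m + n)%N (x * y);
  grading_span : forall x, exists N (f : nat -> W),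
    (forall n, deg n (f n)) /\ x = \sum_(n < N) f n;
  grading_direct : forall N (f : nat -> W), (forall n, deg n (f n)) ->
    \sum_(n < N) f n = 0 -> forall n, (n < N)%N -> f n = 0
}.

Record is_differential (deg : nat -> set W) (d : W -> W) : Prop := {
  diff_linear : linear d;
  diff_deg : forall n x, deg n x -> deg n.+1 (d x);
  diff_leibniz : forall n x y, deg n x ->
    d (x * y) = d x * y + (-1) ^+ n * (x * d y);
  diff_sq0 : forall x, d (d x) = 0
}.

Definition is_dga (deg : nat -> set W) (d : W -> W) : Prop :=
  is_grading deg /\ is_differential deg d.

Record is_dg_ideal (deg : nat -> set W) (d : W -> W) (I : set W) : Prop := {
  dgi_0 : I 0;
  dgi_add : forall x y, I x -> I y -> I (x + y);
  dgi_mull : forall x y, I y -> I (x * y);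
  dgi_mulr : forall x y, I x -> I (x * y);
  dgi_homog : forall x, I x -> exists N (f : nat -> W),
    (forall n, deg n (f n) /\ I (f n)) /\ x = \sum_(n < N) f n;
  dgi_diff : forall x, I x -> I (d x)
}.

End GradedAlgebra.

Section UniversalCalculus.
Variables (K : comNzRingType) (A : algType K).

Lemma mul_bilinear : bilinear_map (fun a b : A => a * b).
Proof.
by split=> [b c x y|a c x y]; rewrite ?mulrDl ?mulrDr -?scalerAl -?scalerAr.
Qed.

Definition tens_mul : tensor A A -> A := tensor_lift (fun a b : A => a * b).

HB.instance Definition _ := GRing.isLinear.Build K (tensor A A) A _ tens_mul
  (tensor_lift_linear mul_bilinear).

Lemma tens_mulE a b : tens_mul (tens a b) = a * b.
Proof. exact: (tensor_lift_tens mul_bilinear). Qed.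

Definition in_Omega1 : {pred tensor A A} := fun m => tens_mul m == 0.

Lemma in_Omega1_submod : submod_closed in_Omega1.
Proof.
split=> [|c x y /eqP x0 /eqP y0]; apply/eqP; first exact: linear0.
by rewrite linearP /= x0 y0 scaler0 addr0.
Qed.
HB.instance Definition _ :=
  GRing.isSubmodClosed.Build K (tensor A A) in_Omega1 in_Omega1_submod.

Record Omega1_univ := MkOmega1 { o1val : tensor A A; _ : in_Omega1 o1val }.
HB.instance Definition _ := [isSub for o1val].
HB.instance Definition _ := [Choice of Omega1_univ by <:].
HB.instance Definition _ := [SubChoice_isSubLmodule of Omega1_univ by <:].

Lemma tens_left_bilinear (a : A) : bilinear_map (fun x y : A => tens (a * x) y).
Proof.
by split=> [y c x x'|x c y y'];
  rewrite ?mulrDr -?scalerAr ?tensDl ?tensDr ?tensZl ?tensZr.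
Qed.

Lemma tens_right_bilinear (a : A) : bilinear_map (fun x y : A => tens x (y * a)).
Proof.
by split=> [y c x x'|x c y y'];
  rewrite ?mulrDl -?scalerAl ?tensDl ?tensDr ?tensZl ?tensZr.
Qed.

Definition tens_left (a : A) : tensor A A -> tensor A A :=
  tensor_lift (fun x y => tens (a * x) y).
Definition tens_right (m : tensor A A) (a : A) : tensor A A :=
  tensor_lift (fun x y => tens x (y * a)) m.

Lemma tens_leftE a x y : tens_left a (tens x y) = tens (a * x) y.
Proof. exact: (tensor_lift_tens (tens_left_bilinear a)). Qed.
Lemma tens_rightE a x y : tens_right (tens x y) a = tens x (y * a).
Proof. exact: (tensor_lift_tens (tens_right_bilinear a)). Qed.
Lemma tens_left_linear a : linear (tens_left a).
Proof. exact: tensor_lift_linear (tens_left_bilinear a). Qed.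
Lemma tens_right_linear a : linear (tens_right^~ a).
Proof. exact: tensor_lift_linear (tens_right_bilinear a). Qed.

Lemma lin_add (U V : lmodType K) (f : U -> V) : linear f ->
  forall x y, f (x + y) = f x + f y.
Proof. by move=> lf x y; have := lf 1 x y; rewrite !scale1r. Qed.
Lemma lin_0 (U V : lmodType K) (f : U -> V) : linear f -> f 0 = 0.
Proof. by move=> lf; apply: (@addrI _ (f 0)); rewrite -(lin_add lf) !addr0. Qed.
Lemma lin_scale (U V : lmodType K) (f : U -> V) : linear f ->
  forall c x, f (c *: x) = c *: f x.
Proof. by move=> lf c x; have := lf c x 0; rewrite (lin_0 lf) !addr0. Qed.

Lemma tens_mul_left a m : tens_mul (tens_left a m) = a * tens_mul m.
Proof.
have lf := tens_left_linear a.
elim/tensor_ind: m => [x y|x y IHx IHy|c x IHx].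
- by rewrite tens_leftE !tens_mulE mulrA.
- by rewrite (lin_add lf) !linearD /= IHx IHy mulrDr.
- by rewrite (lin_scale lf) !linearZ /= IHx scalerAr.
Qed.

Lemma tens_mul_right m a : tens_mul (tens_right m a) = tens_mul m * a.
Proof.
have lf := tens_right_linear a.
elim/tensor_ind: m => [x y|x y IHx IHy|c x IHx].
- by rewrite tens_rightE !tens_mulE mulrA.
- by rewrite (lin_add lf) !linearD /= IHx IHy mulrDl.
- by rewrite (lin_scale lf) !linearZ /= IHx scalerAl.
Qed.

Lemma Omega1_mul (m : Omega1_univ) : tens_mul (val m) = 0.
Proof. exact/eqP/(valP m). Qed.

Lemma o1_left_subproof a (m : Omega1_univ) : in_Omega1 (tens_left a (val m)).
Proof. by apply/eqP; rewrite tens_mul_left Omega1_mul mulr0. Qed.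
Lemma o1_right_subproof (m : Omega1_univ) a : in_Omega1 (tens_right (val m) a).
Proof. by apply/eqP; rewrite tens_mul_right Omega1_mul mul0r. Qed.
Lemma o1_d_subproof a : in_Omega1 (tens 1 a - tens a 1).
Proof. by apply/eqP; rewrite linearB /= !tens_mulE mul1r mulr1 subrr. Qed.

Definition o1_left a (m : Omega1_univ) := MkOmega1 (o1_left_subproof a m).
Definition o1_right (m : Omega1_univ) a := MkOmega1 (o1_right_subproof m a).
Definition o1_d (a : A) : Omega1_univ := MkOmega1 (o1_d_subproof a).

Definition Omega_univ : algType K := tensor_alg o1_left o1_right.
Definition univ_base : A -> Omega_univ := @tbase K A _ o1_left o1_right.
Definition univ_vec : Omega1_univ -> Omega_univ := @tvec K A _ o1_left o1_right.
Definition univ_deg : nat -> set Omega_univ := @tdeg K A _ o1_left o1_right.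

(* The universal differential: d a = 1 (x) a - a (x) 1 on A, which forces
   d (sum a_i (x) b_i) = sum da_i db_i on the kernel of multiplication. *)
Definition univ_db (a : A) : Omega_univ := univ_vec (o1_d a).

Definition univ_d1 : tensor A A -> Omega_univ :=
  tensor_lift (fun x y => univ_db x * univ_db y).

Fixpoint sgn_eval (t : talg_term A Omega1_univ) : Omega_univ :=
  match t with
  | GBase a => univ_base a
  | GVec m => - univ_vec m
  | GAdd s t => sgn_eval s + sgn_eval t
  | GMul s t => sgn_eval s * sgn_eval t
  | GScale c t => c *: sgn_eval t
  end.

Fixpoint d_eval (t : talg_term A Omega1_univ) : Omega_univ :=
  match t with
  | GBase a => univ_db a
  | GVec m => univ_d1 (val m)
  | GAdd s t => d_eval s + d_eval t
  | GMul s t => d_eval s * talg_class o1_left o1_right t + sgn_eval s * d_eval t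
  | GScale c t => c *: d_eval t
  end.

Definition univ_d (x : Omega_univ) : Omega_univ := d_eval (repr x).

Lemma univ_vec_linear : linear univ_vec.
Proof. by move=> c x y; rewrite /univ_vec tvecD tvecZ. Qed.

Lemma o1_d_linear : linear o1_d.
Proof.
move=> c x y; apply: val_inj; rewrite linearP /=.
by rewrite tensDl tensDr tensZl tensZr scalerBr opprD addrACA.
Qed.

Lemma univ_db_linear : linear univ_db.
Proof. by move=> c x y; rewrite /univ_db o1_d_linear univ_vec_linear. Qed.

Lemma univ_d1_bilinear : bilinear_map (fun x y => univ_db x * univ_db y).
Proof.
by split=> [y c x x'|x c y y'];
  rewrite univ_db_linear ?mulrDl ?mulrDr -?scalerAl -?scalerAr.
Qed.

Lemma univ_d1_linear : linear univ_d1.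
Proof. exact: tensor_lift_linear univ_d1_bilinear. Qed.

Lemma univ_d1E x y : univ_d1 (tens x y) = univ_db x * univ_db y.
Proof. exact: (tensor_lift_tens univ_d1_bilinear). Qed.

Lemma univ_dbM a b :
  univ_db (a * b) = univ_db a * univ_base b + univ_base a * univ_db b.
Proof.
rewrite /univ_db /univ_base /univ_vec -tvecr -tvecl -tvecD; congr tvec.
apply: val_inj; rewrite linearD /=.
have lr := tens_right_linear b; have ll := tens_left_linear a.
rewrite (lin_add lr) (lin_add ll) -!scaleN1r (lin_scale lr) (lin_scale ll).
by rewrite !tens_rightE !tens_leftE mul1r mulr1 !scaleN1r subrKA.
Qed.

(* x (x) y |-> x dy and x (x) y |-> dx y, and their values on the kernel. *)
Lemma vec_xdy_bilinear : bilinear_map (fun x y => univ_base x * univ_db y).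
Proof.
by split=> [y c x x'|x c y y'];
  rewrite ?univ_db_linear /univ_base ?tbaseD ?tbaseZ ?mulrDl ?mulrDr
    -?scalerAl -?scalerAr.
Qed.

Lemma vec_dxy_bilinear : bilinear_map (fun x y => univ_db x * univ_base y).
Proof.
by split=> [y c x x'|x c y y'];
  rewrite ?univ_db_linear /univ_base ?tbaseD ?tbaseZ ?mulrDl ?mulrDr
    -?scalerAl -?scalerAr.
Qed.

Lemma univ_vec_inj1 (m : tensor A A) :
  exists2 n : Omega1_univ, val n = m - tens (tens_mul m) 1 &
  univ_vec n = tensor_lift (fun x y => univ_base x * univ_db y) m.
Proof.
have lf := tensor_lift_linear vec_xdy_bilinear.
elim/tensor_ind: m => [x y|x y [n nx En] [n' ny En']|c x [n nx En]].
- exists (o1_left x (o1_d y)).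
    rewrite /= (lin_add (tens_left_linear x)) -!scaleN1r.
    by rewrite (lin_scale (tens_left_linear x)) !tens_leftE mulr1 tens_mulE.
  by rewrite (tensor_lift_tens vec_xdy_bilinear) /univ_vec tvecl.
- exists (n + n'); last by rewrite (lin_add univ_vec_linear) (lin_add lf) En En'.
  by rewrite linearD /= nx ny linearD /= tensDl opprD addrACA.
- exists (c *: n); last by rewrite (lin_scale univ_vec_linear) (lin_scale lf) En.
  by rewrite linearZ /= nx linearZ /= tensZl scalerBr.
Qed.

Lemma univ_vec_xdy (m : Omega1_univ) :
  univ_vec m = tensor_lift (fun x y => univ_base x * univ_db y) (val m).
Proof.
have [n nm <-] := univ_vec_inj1 (val m); congr univ_vec; apply: val_inj.
by rewrite nm Omega1_mul -(scale0r 0) tensZl scale0r subr0.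
Qed.

Lemma univ_vec_inj2 (m : tensor A A) :
  exists2 n : Omega1_univ, val n = tens 1 (tens_mul m) - m &
  univ_vec n = tensor_lift (fun x y => univ_db x * univ_base y) m.
Proof.
have lf := tensor_lift_linear vec_dxy_bilinear.
elim/tensor_ind: m => [x y|x y [n nx En] [n' ny En']|c x [n nx En]].
- exists (o1_right (o1_d x) y).
    rewrite /= (lin_add (tens_right_linear y)) -!scaleN1r.
    by rewrite (lin_scale (tens_right_linear y)) !tens_rightE mul1r tens_mulE.
  by rewrite (tensor_lift_tens vec_dxy_bilinear) /univ_vec tvecr.
- exists (n + n'); last by rewrite (lin_add univ_vec_linear) (lin_add lf) En En'.
  by rewrite linearD /= nx ny linearD /= tensDr opprD addrACA.
- exists (c *: n); last by rewrite (lin_scale univ_vec_linear) (lin_scale lf) En.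
  by rewrite linearZ /= nx linearZ /= tensZr scalerBr.
Qed.

Lemma univ_vec_dxy (m : Omega1_univ) :
  - univ_vec m = tensor_lift (fun x y => univ_db x * univ_base y) (val m).
Proof.
have [n nm <-] := univ_vec_inj2 (val m).
rewrite -scaleN1r -(lin_scale univ_vec_linear); congr univ_vec; apply: val_inj.
by rewrite nm Omega1_mul -(scale0r 0) tensZr scale0r sub0r linearZ /= scaleN1r.
Qed.

Lemma univ_d1_left a (m : Omega1_univ) :
  univ_d1 (tens_left a (val m)) =
    univ_db a * univ_vec m + univ_base a * univ_d1 (val m).
Proof.
rewrite univ_vec_xdy; elim/tensor_ind: (val m) => [x y|x y IHx IHy|c x IHx].
- rewrite tens_leftE !univ_d1E (tensor_lift_tens vec_xdy_bilinear).
  by rewrite univ_dbM mulrDl !mulrA.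
- rewrite (lin_add (tens_left_linear a)) !(lin_add univ_d1_linear) IHx IHy.
  by rewrite (lin_add (tensor_lift_linear vec_xdy_bilinear)) !mulrDr addrACA.
- rewrite (lin_scale (tens_left_linear a)) !(lin_scale univ_d1_linear) IHx.
  rewrite (lin_scale (tensor_lift_linear vec_xdy_bilinear)).
  by rewrite -!scalerAr scalerDr.
Qed.

Lemma univ_d1_right a (m : Omega1_univ) :
  univ_d1 (tens_right (val m) a) =
    univ_d1 (val m) * univ_base a + - univ_vec m * univ_db a.
Proof.
rewrite univ_vec_dxy; elim/tensor_ind: (val m) => [x y|x y IHx IHy|c x IHx].
- rewrite tens_rightE !univ_d1E (tensor_lift_tens vec_dxy_bilinear).
  by rewrite univ_dbM mulrDr !mulrA.
- rewrite (lin_add (tens_right_linear a)) !(lin_add univ_d1_linear) IHx IHy.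
  by rewrite (lin_add (tensor_lift_linear vec_dxy_bilinear)) !mulrDl addrACA.
- rewrite (lin_scale (tens_right_linear a)) !(lin_scale univ_d1_linear) IHx.
  rewrite (lin_scale (tensor_lift_linear vec_dxy_bilinear)).
  by rewrite -!scalerAl scalerDr.
Qed.

Lemma univ_db1 : univ_db 1 = 0.
Proof.
rewrite /univ_db (_ : o1_d 1 = 0) ?(lin_0 univ_vec_linear) //.
by apply: val_inj; rewrite /= subrr.
Qed.

Lemma sgn_eval_eq s t : talg_eq o1_left o1_right s t ->
  sgn_eval s = sgn_eval t.
Proof.
elim=> //= {s t}.
- by move=> t s u _ -> _ ->.
- by move=> s s' t t' _ -> _ ->.
- by move=> s s' t t' _ -> _ ->.
- by move=> c t t' _ ->.
- by move=> s t u; rewrite addrA.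
- by move=> s t; rewrite addrC.
- by move=> t; rewrite [univ_base 0]/(0 : Omega_univ) add0r.
- by move=> t; rewrite scaleN1r addNr.
- by move=> a b t; rewrite scalerA.
- by move=> t; rewrite scale1r.
- by move=> c s t; rewrite scalerDr.
- by move=> a b t; rewrite scalerDl.
- by move=> s t u; rewrite mulrA.
- by move=> t; rewrite [univ_base 1]/(1 : Omega_univ) mul1r.
- by move=> t; rewrite [univ_base 1]/(1 : Omega_univ) mulr1.
- by move=> s t u; rewrite mulrDl.
- by move=> s t u; rewrite mulrDr.
- by move=> c s t; rewrite scalerAl.
- by move=> c s t; rewrite scalerAr.
- by move=> a b; exact: tbaseD.
- by move=> a b; exact: tbaseM.
- by move=> c a; exact: tbaseZ.
- by move=> m n; rewrite (lin_add univ_vec_linear) opprD.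
- by move=> c m; rewrite (lin_scale univ_vec_linear) scalerN.
- by move=> a m; rewrite mulrN; congr (- _); exact: tvecl.
- by move=> m a; rewrite mulNr; congr (- _); exact: tvecr.
Qed.

Let cls : talg_term A Omega1_univ -> Omega_univ := talg_class o1_left o1_right.

Lemma clsD s t : cls (GAdd s t) = cls s + cls t.
Proof. by rewrite [RHS]talg_addE. Qed.
Lemma clsM s t : cls (GMul s t) = cls s * cls t.
Proof. by rewrite [RHS]talg_mulE. Qed.
Lemma clsZ c t : cls (GScale c t) = c *: cls t.
Proof. by rewrite [RHS]talg_scaleE. Qed.

Lemma d_eval_eq s t : talg_eq o1_left o1_right s t -> d_eval s = d_eval t.
Proof.
elim=> //= {s t}; rewrite -?/(cls _).
- by move=> t s u _ -> _ ->.
- by move=> s s' t t' _ -> _ ->.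
- move=> s s' t t' ss' -> /[dup] /talg_classP tt' _ ->.
  by rewrite -/(cls _) /cls tt' (sgn_eval_eq ss').
- by move=> c t t' _ ->.
- by move=> s t u; rewrite addrA.
- by move=> s t; rewrite addrC.
- by move=> t; rewrite (lin_0 univ_db_linear) add0r.
- by move=> t; rewrite scaleN1r addNr (lin_0 univ_db_linear).
- by move=> a b t; rewrite scalerA.
- by move=> t; rewrite scale1r.
- by move=> c s t; rewrite scalerDr.
- by move=> a b t; rewrite scalerDl.
- by move=> s t u; rewrite -!/(cls _) clsM mulrDl mulrDr !mulrA addrA.
- by move=> t; rewrite univ_db1 mul0r add0r [univ_base 1]/(1 : Omega_univ) mul1r.
- move=> t; rewrite univ_db1 mulr0 addr0.
  by rewrite -[RHS]mulr1.
- by move=> s t u; rewrite !mulrDl addrACA.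
- by move=> s t u; rewrite -!/(cls _) clsD !mulrDr addrACA.
- by move=> c s t; rewrite scalerDr !scalerAl.
- by move=> c s t; rewrite -!/(cls _) clsZ scalerDr !scalerAr.
- by move=> a b; exact: (lin_add univ_db_linear).
- by move=> a b; exact: univ_dbM.
- by move=> c a; exact: (lin_scale univ_db_linear).
- by move=> m n; exact: (lin_add univ_d1_linear).
- by move=> c m; exact: (lin_scale univ_d1_linear).
- by move=> a m; exact: univ_d1_left.
- by move=> m a; exact: univ_d1_right.
Qed.

Lemma univ_dE t : univ_d (cls t) = d_eval t.
Proof. exact/d_eval_eq/talg_repr_eq. Qed.

Definition univ_sgn (x : Omega_univ) : Omega_univ := sgn_eval (repr x).
Lemma univ_sgnE t : univ_sgn (cls t) = sgn_eval t.
Proof. exact/sgn_eval_eq/talg_repr_eq. Qed.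

Lemma univ_d_base a : univ_d (univ_base a) = univ_vec (o1_d a).
Proof. exact: univ_dE. Qed.

Lemma univ_d_vec m : univ_d (univ_vec m) = univ_d1 (val m).
Proof. exact: univ_dE. Qed.

Lemma univ_d_linear : linear univ_d.
Proof.
move=> c x y; rewrite -(talg_reprK x) -(talg_reprK y) -!/(cls _).
by rewrite -clsZ -clsD !univ_dE.
Qed.

Lemma univ_sgn_linear : linear univ_sgn.
Proof.
move=> c x y; rewrite -(talg_reprK x) -(talg_reprK y) -!/(cls _).
by rewrite -clsZ -clsD !univ_sgnE.
Qed.

Lemma univ_sgnM x y : univ_sgn (x * y) = univ_sgn x * univ_sgn y.
Proof.
rewrite -(talg_reprK x) -(talg_reprK y) -!/(cls _).
by rewrite -clsM !univ_sgnE.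
Qed.

Lemma univ_dM x y : univ_d (x * y) = univ_d x * y + univ_sgn x * univ_d y.
Proof.
rewrite -(talg_reprK x) -(talg_reprK y) -!/(cls _).
by rewrite -clsM !univ_dE univ_sgnE.
Qed.

Lemma univ_sgn_sum (I : Type) (s : seq I) (F : I -> Omega_univ) :
  univ_sgn (\sum_(i <- s) F i) = \sum_(i <- s) univ_sgn (F i).
Proof.
by apply: big_morph; [exact: (lin_add univ_sgn_linear)|exact: (lin_0 univ_sgn_linear)].
Qed.

Lemma univ_d_sum (I : Type) (s : seq I) (F : I -> Omega_univ) :
  univ_d (\sum_(i <- s) F i) = \sum_(i <- s) univ_d (F i).
Proof.
by apply: big_morph; [exact: (lin_add univ_d_linear)|exact: (lin_0 univ_d_linear)].
Qed.

Lemma univ_sgn_prod (s : seq Omega1_univ) :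
  univ_sgn (\prod_(m <- s) univ_vec m) =
  (-1) ^+ size s * \prod_(m <- s) univ_vec m.
Proof.
elim: s => [|m s IHs]; first by rewrite big_nil mulr1 [LHS](univ_sgnE (GBase _ 1)).
rewrite big_cons univ_sgnM IHs [univ_sgn _](univ_sgnE (GVec _ m)) /=.
by rewrite exprS mulN1r !mulNr !mulrA (commr_sign (univ_vec m)).
Qed.

Lemma univ_sgn_deg n x : univ_deg n x -> univ_sgn x = (-1) ^+ n * x.
Proof.
move=> [s ->]; rewrite univ_sgn_sum mulr_sumr; apply: eq_bigr => p _.
rewrite univ_sgnM univ_sgn_prod size_tuple [univ_sgn _](univ_sgnE (GBase _ _)) /=.
by rewrite !mulrA (commr_sign (univ_base p.1)).
Qed.

Lemma univ_degD n x y : univ_deg n x -> univ_deg n y -> univ_deg n (x + y).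
Proof. by move=> [s ->] [t ->]; exists (s ++ t); rewrite big_cat. Qed.

Lemma univ_deg0 n : univ_deg n 0.
Proof. by exists [::]; rewrite big_nil. Qed.

Lemma univ_deg_sum n (I : Type) (s : seq I) (F : I -> Omega_univ) :
  (forall i, univ_deg n (F i)) -> univ_deg n (\sum_(i <- s) F i).
Proof.
move=> hF; apply: big_ind => //; first exact: univ_deg0.
exact: univ_degD.
Qed.

Lemma univ_deg_mono a (s : seq Omega1_univ) :
  univ_deg (size s) (univ_base a * \prod_(m <- s) univ_vec m).
Proof. by exists [:: (a, in_tuple s)]; rewrite big_seq1. Qed.

Lemma univ_deg_basel n a x : univ_deg n x -> univ_deg n (univ_base a * x).
Proof.
move=> [s ->]; rewrite mulr_sumr; apply: univ_deg_sum => p.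
rewrite mulrA -[univ_base a * _]tbaseM -[n in univ_deg n](size_tuple p.2).
exact: univ_deg_mono.
Qed.

Lemma univ_degZ n c x : univ_deg n x -> univ_deg n (c *: x).
Proof.
move=> hx; suff -> : c *: x = univ_base (c *: 1) * x by exact: univ_deg_basel.
by rewrite [univ_base (c *: 1)]tbaseZ -scalerAl [tbase _ _ _]/(1 : Omega_univ) mul1r.
Qed.

Lemma univ_deg_baser n a x : univ_deg n x -> univ_deg n (x * univ_base a).
Proof.
move=> [s ->]; rewrite mulr_suml; apply: univ_deg_sum => -[b t] /=.
case: n t {s} => [|n] t.
  rewrite (tuple0 t) big_nil mulr1 -[_ * _]tbaseM.
  by have := univ_deg_mono (b * a) [::]; rewrite big_nil mulr1.
have [s [m Et]] : exists s m, val t = rcons s m.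
  case: t => t /=; case/lastP: t => // s m _; by exists s, m.
have -> : univ_base b * \prod_(m <- t) univ_vec m * univ_base a =
    univ_base b * \prod_(m <- rcons s (o1_right m a)) univ_vec m.
  rewrite Et -!cats1 !big_cat !big_seq1 /= -!mulrA.
  by congr (_ * (_ * _)); rewrite -[LHS]tvecr.
have := univ_deg_mono b (rcons s (o1_right m a)).
by rewrite size_rcons -(size_rcons s m) -Et size_tuple.
Qed.

Lemma univ_degM m n x y :
  univ_deg m x -> univ_deg n y -> univ_deg (m + n)%N (x * y).
Proof.
move=> hx [t ->]; rewrite mulr_sumr; apply: univ_deg_sum => -[b u] /=.
rewrite mulrA; have [s ->] := univ_deg_baser b hx.
rewrite mulr_suml; apply: univ_deg_sum => -[a v] /=.
have := univ_deg_mono a (v ++ u); rewrite size_cat !size_tuple.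
by rewrite big_cat mulrA.
Qed.

Lemma univ_deg_vec m : univ_deg 1 (univ_vec m).
Proof.
have := univ_deg_mono 1 [:: m].
by rewrite big_seq1 [univ_base 1]/(1 : Omega_univ) mul1r.
Qed.

Lemma univ_deg_base a : univ_deg 0 (univ_base a).
Proof. by have := univ_deg_mono a [::]; rewrite big_nil mulr1. Qed.

Lemma univ_deg_d1 m : univ_deg 2 (univ_d1 m).
Proof.
elim/tensor_ind: m => [x y|x y hx hy|c x hx].
- by rewrite univ_d1E; apply: (@univ_degM 1 1); exact: univ_deg_vec.
- by rewrite (lin_add univ_d1_linear); exact: univ_degD.
- by rewrite (lin_scale univ_d1_linear); exact: univ_degZ.
Qed.

Lemma univ_d_deg n x : univ_deg n x -> univ_deg n.+1 (univ_d x).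
Proof.
move=> [s ->]; rewrite univ_d_sum; apply: univ_deg_sum => -[a t] /=.
have hprod (u : seq Omega1_univ) :
    univ_deg (size u) (\prod_(m <- u) univ_vec m).
  have := univ_deg_mono 1 u.
  by rewrite [univ_base 1]/(1 : Omega_univ) mul1r.
have hd (u : seq Omega1_univ) :
    univ_deg (size u).+1 (univ_d (\prod_(m <- u) univ_vec m)).
  elim: u => [|m u IHu].
    rewrite big_nil -[1]/(univ_base 1) univ_d_base -/(univ_db _) univ_db1.
    exact: univ_deg0.
  rewrite big_cons univ_dM univ_d_vec; apply: univ_degD.
    exact: (univ_degM (univ_deg_d1 _) (hprod u)).
  rewrite [univ_sgn _](univ_sgn_deg (univ_deg_vec m)) expr1 mulN1r mulNr.
  rewrite -scaleN1r; apply: univ_degZ.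
  exact: (univ_degM (univ_deg_vec m) IHu).
rewrite univ_dM univ_d_base; apply: univ_degD.
  have := univ_degM (univ_deg_vec (o1_d a)) (hprod t).
  by rewrite size_tuple.
rewrite [univ_sgn _](univ_sgn_deg (univ_deg_base a)) mul1r.
by apply: univ_deg_basel; rewrite -{1}(size_tuple t).
Qed.

Lemma univ_d_sq0 x : univ_d (univ_d x) = 0.
Proof.
have db0 a : univ_d (univ_db a) = 0.
  rewrite univ_d_vec /=.
  rewrite (lin_add univ_d1_linear) -scaleN1r (lin_scale univ_d1_linear).
  by rewrite !univ_d1E univ_db1 mul0r mulr0 scaler0 addr0.
have sgnd y : univ_sgn (univ_d y) = - univ_d (univ_sgn y).
  elim/talg_ind: y => [a|m|y z IHy IHz|y z IHy IHz|c y IHy].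
  - rewrite -/(univ_base a) univ_d_base (univ_sgn_deg (univ_deg_vec _)).
    by rewrite (univ_sgn_deg (univ_deg_base a)) mul1r expr1 mulN1r univ_d_base.
  - rewrite -/(univ_vec m) univ_d_vec (univ_sgn_deg (univ_deg_d1 _)).
    rewrite (univ_sgn_deg (univ_deg_vec m)) expr1 mulN1r -scaleN1r.
    by rewrite (lin_scale univ_d_linear) scaleN1r opprK univ_d_vec sqrrN expr1n mul1r.
  - rewrite (lin_add univ_d_linear) !(lin_add univ_sgn_linear) IHy IHz.
    by rewrite (lin_add univ_d_linear) opprD.
  - rewrite univ_dM (lin_add univ_sgn_linear) !univ_sgnM IHy IHz univ_dM.
    by rewrite mulNr mulrN opprD.
  - by rewrite (lin_scale univ_d_linear) !(lin_scale univ_sgn_linear) IHy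
      (lin_scale univ_d_linear) scalerN.
elim/talg_ind: x => [a|m|x y IHx IHy|x y IHx IHy|c x IHx].
- by rewrite -/(univ_base a) univ_d_base; exact: db0.
- rewrite -/(univ_vec m) univ_d_vec.
  elim/tensor_ind: (val m) => [x y|x y IHx IHy|c x IHx].
  + by rewrite univ_d1E univ_dM !db0 mul0r mulr0 addr0.
  + by rewrite (lin_add univ_d1_linear) (lin_add univ_d_linear) IHx IHy addr0.
  + by rewrite (lin_scale univ_d1_linear) (lin_scale univ_d_linear) IHx scaler0.
- by rewrite !(lin_add univ_d_linear) IHx IHy addr0.
- rewrite univ_dM (lin_add univ_d_linear) !univ_dM IHx IHy sgnd.
  by rewrite mul0r mulr0 add0r addr0 mulNr addNr.
- by rewrite !(lin_scale univ_d_linear) IHx scaler0.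
Qed.

Lemma univ_d_differential : is_differential univ_deg univ_d.
Proof.
split; [exact: univ_d_linear|exact: univ_d_deg| |exact: univ_d_sq0].
by move=> n x y hx; rewrite univ_dM (univ_sgn_deg hx) mulrA.
Qed.

End UniversalCalculus.

Section UniversalUnique.
Variables (K : comNzRingType) (A : algType K).

Lemma Omega_univ_ind (P : Omega_univ A -> Prop) : P 0 ->
  (forall x y, P x -> P y -> P (x + y)) ->
  (forall n x, univ_deg n x -> P x) -> forall x, P x.
Proof.
move=> P0 PD Pdeg x.
suff [s [hs ->]] : exists s : seq (Omega_univ A),
    (forall y, y \in s -> exists n, univ_deg n y) /\ x = \sum_(y <- s) y.
  elim: s {x} hs => [|y s IHs] hs; rewrite ?big_nil // big_cons; apply: PD.
    by have [n /Pdeg] := hs y (mem_head _ _).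
  by apply: IHs => z zs; apply: hs; rewrite in_cons zs orbT.
elim/talg_ind: x => [a|m|x y [s [hs ->]] [t [ht ->]]|
    x y [s [hs ->]] [t [ht ->]]|c x [s [hs ->]]].
- exists [:: univ_base a]; rewrite big_seq1; split=> // y; rewrite inE => /eqP ->.
  by exists 0; exact: univ_deg_base.
- exists [:: univ_vec m]; rewrite big_seq1; split=> // y; rewrite inE => /eqP ->.
  by exists 1; exact: univ_deg_vec.
- exists (s ++ t); rewrite big_cat; split=> // z.
  by rewrite mem_cat => /orP[/hs|/ht].
- exists [seq u * v | u <- s, v <- t]; rewrite big_allpairs_dep; split.
    move=> _ /allpairsP[[u v] /= [/hs[m um] /ht[n vn] ->]].
    by exists (m + n)%N; exact: univ_degM.
  by rewrite mulr_suml; apply: eq_bigr => u _; rewrite mulr_sumr.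
- exists [seq c *: y | y <- s]; rewrite big_map scaler_sumr; split=> //.
  by move=> _ /mapP[y /hs[n ny] ->]; exists n; exact: univ_degZ.
Qed.

Lemma univ_d_unique (D : Omega_univ A -> Omega_univ A) :
  is_differential (@univ_deg K A) D ->
  (forall a, D (univ_base a) = univ_vec (o1_d a)) -> D =1 @univ_d K A.
Proof.
move=> [Dlin _ Dleib Dsq] Dbase.
have Dvec m : D (univ_vec m) = univ_d (univ_vec m).
  rewrite univ_d_vec univ_vec_xdy.
  have lx := tensor_lift_linear (@vec_xdy_bilinear K A).
  elim/tensor_ind: (val m) => [x y|x y IHx IHy|c x IHx].
  - rewrite (tensor_lift_tens (@vec_xdy_bilinear K A)) univ_d1E.
    rewrite (Dleib _ _ _ (univ_deg_base x)) Dbase -/(univ_db x) /univ_db.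
    by rewrite -(Dbase y) Dsq !mulr0 addr0.
  - by rewrite (lin_add lx) (lin_add Dlin) IHx IHy (lin_add (@univ_d1_linear _ _)).
  - by rewrite (lin_scale lx) (lin_scale Dlin) IHx
      (lin_scale (@univ_d1_linear _ _)).
have [dlin _ dleib _] := univ_d_differential A.
have Dprod (s : seq (Omega1_univ A)) :
    D (\prod_(m <- s) univ_vec m) = univ_d (\prod_(m <- s) univ_vec m).
  elim: s => [|m s IHs].
    by rewrite big_nil -[1]/(univ_base 1) Dbase univ_d_base.
  by rewrite big_cons (Dleib _ _ _ (univ_deg_vec m)) (dleib _ _ _ (univ_deg_vec m))
    Dvec IHs.
elim/Omega_univ_ind => [|x y Dx Dy|n x [s ->]].
- by rewrite (lin_0 Dlin) (lin_0 dlin).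
- by rewrite (lin_add Dlin) (lin_add dlin) Dx Dy.
- elim: s => [|[a t] s IHs]; first by rewrite big_nil (lin_0 Dlin) (lin_0 dlin).
  rewrite big_cons (lin_add Dlin) (lin_add dlin) IHs; congr (_ + _).
  rewrite [LHS](Dleib _ _ _ (univ_deg_base a)).
  rewrite [RHS](dleib _ _ _ (univ_deg_base a)).
  by rewrite Dprod Dbase univ_d_base.
Qed.

End UniversalUnique.

Section DifferentialCalculus.
Variables (K : comNzRingType) (A W : algType K).

(* W is, up to isomorphism, the quotient of the universal calculus by I. *)
Record is_quotient_of_universal (iota : A -> W) (deg : nat -> set W)
    (d : W -> W) (I : set (Omega_univ A)) (phi : {lrmorphism Omega_univ A -> W})
    : Prop := {
  quo_ideal : is_dg_ideal (@univ_deg K A) (@univ_d K A) I;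
  quo_ideal0 : forall x, univ_deg 0%N x -> I x -> x = 0;
  quo_surj : forall y, exists x, phi x = y;
  quo_ker : forall x, phi x = 0 <-> I x;
  quo_deg : forall n y, deg n y <-> exists2 x, univ_deg n x & phi x = y;
  quo_diff : forall x, phi (univ_d x) = d (phi x);
  quo_base : forall a, phi (univ_base a) = iota a
}.

(* [iota] is the identification of A with the degree-zero part. *)
Definition is_differential_calculus (iota : A -> W) (deg : nat -> set W)
    (d : W -> W) : Prop :=
  is_dga deg d /\ exists I phi, is_quotient_of_universal iota deg d I phi.

End DifferentialCalculus.

Section StarCalculus.
Variable R : realType.
Local Notation C := R[i].

Record is_star_algebra (A : algType C) (star : A -> A) : Prop := {
  starD : forall a b, star (a + b) = star a + star b;
  starZ : forall (c : C) a, star (c *: a) = conjc c *: star a;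
  starK : forall a, star (star a) = a;
  starM : forall a b, star (a * b) = star b * star a
}.

Variables (A Omega : algType C) (starA : A -> A) (iota : A -> Omega).
Variables (deg : nat -> set Omega) (d : Omega -> Omega).
Variable (star : Omega -> Omega).

Record is_star_calculus : Prop := {
  sc_calculus : is_differential_calculus iota deg d;
  sc_starD : forall x y, star (x + y) = star x + star y;
  sc_starZ : forall (c : C) x, star (c *: x) = conjc c *: star x;
  sc_starK : forall x, star (star x) = x;
  sc_deg : forall n x, deg n x -> deg n (star x);
  sc_iota : forall a, star (iota a) = iota (starA a);
  sc_diff : forall x, star (d x) = d (star x);
  sc_mul : forall m n x y, deg m x -> deg n y ->
    star (x * y) = (-1) ^+ (m * n)%N * (star y * star x)
}.

Variable J : Omega -> Omega.

Record is_almost_complex : Prop := {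
  ac_linear : linear J;
  ac_deg : forall n x, deg n x -> deg n (J x);
  ac_derivation : forall x y, J (x * y) = J x * y + x * J y;
  ac_base : forall a, J (iota a) = 0;
  ac_sq : forall x, deg 1%N x -> J (J x) = - x;
  ac_star : forall x, deg 1%N x -> J (star x) = star (J x)
}.

Definition bideg (p q : nat) : set Omega :=
  [set x | deg (p + q)%N x /\ J x = ((p%:R - q%:R) * 'i%C) *: x].

Definition integrable : Prop := forall x, bideg 1%N 0%N x ->
  exists y z, [/\ bideg 2%N 0%N y, bideg 1%N 1%N z & d x = y + z].

(* The projection of Omega^{p+q} onto the summand Omega^{p,q}; it is 0 on
   elements that have no decomposition into summands of total degree p + q. *)
Definition bideg_proj (p q : nat) (x : Omega) : Omega :=
  xget 0 [set y | exists f : nat -> Omega,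
    [/\ forall k, (k <= p + q)%N -> bideg k (p + q - k)%N (f k),
        x = \sum_(k < (p + q).+1) f k & y = f p]].

(* The additive extension of additive maps F p q on the Omega^{p,q}: the value
   does not depend on the decomposition of x, as the Omega^{p,q} are in direct
   sum. *)
Definition bideg_extend (F : nat -> nat -> Omega -> Omega) (x : Omega) : Omega :=
  xget 0 [set y | exists N (f : nat -> nat -> Omega),
    [/\ forall p q, bideg p q (f p q),
        x = \sum_(p < N) \sum_(q < N) f p q &
        y = \sum_(p < N) \sum_(q < N) F p q (f p q)]].

Definition del : Omega -> Omega :=
  bideg_extend (fun p q x => bideg_proj p.+1 q (d x)).

Definition delbar : Omega -> Omega :=
  bideg_extend (fun p q x => bideg_proj p q.+1 (d x)).

End StarCalculus.

(* Main.v *)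
(** Work with the commutators [J, d] and [J, [J, d]].  Integrability and its
    conjugate say that J^2 d y = 2i J d y for y of type (1,0) and
    J^2 d z = -2i J d z for z of type (0,1), so the graded derivation
    [J, [J, d]] + d vanishes in degrees 0 and 1; these generate, hence
    [J, [J, d]] = -d.  Therefore D_e = (d - e [J, d]) / 2 satisfies
    [J, D_e] = e D_e for e = i, -i: it shifts the bidegree by (1,0), resp.
    (0,1), which identifies del = D_i and delbar = D_(-i).  Finally d^2 = 0
    splits into three terms with distinct J-eigenvalues, all of them zero. *)
Require Import Defs.
From HB Require Import structures.
From mathcomp Require Import all_boot all_order all_algebra.
From mathcomp Require Import boolp classical_sets reals.
From mathcomp Require Import complex.
From mathcomp Require Import ring.

Set Implicit Arguments.
Unset Strict Implicit.
Unset Printing Implicit Defensive.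

Import GRing.Theory Num.Theory.
Local Open Scope ring_scope.

(** * Linear maps, independence of eigenvectors, and generation of a calculus in degrees 0 and 1 *)

Lemma lin_opp (K : comNzRingType) (U V : lmodType K) (f : U -> V) :
  linear f -> forall x, f (- x) = - f x.
Proof. by move=> lf x; rewrite -scaleN1r (lin_scale lf) scaleN1r. Qed.

Lemma lin_sub (K : comNzRingType) (U V : lmodType K) (f : U -> V) :
  linear f -> forall x y, f (x - y) = f x - f y.
Proof. by move=> lf x y; rewrite (lin_add lf) (lin_opp lf). Qed.

Lemma lin_sum (K : comNzRingType) (U V : lmodType K) (f : U -> V)
    (I : Type) : linear f -> forall (s : seq I) (F : I -> U),
  f (\sum_(i <- s) F i) = \sum_(i <- s) f (F i).
Proof. by move=> lf s F; apply: big_morph; [exact: lin_add lf|exact: lin_0 lf]. Qed.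

Lemma lin_sign (K : comNzRingType) (U V : algType K) (f : U -> V) :
  linear f -> forall n x, f ((-1) ^+ n * x) = (-1) ^+ n * f x.
Proof.
move=> lf n x; rewrite -(signr_odd U) -(signr_odd V) !mulr_sign.
by case: odd; rewrite ?(lin_opp lf).
Qed.

(** Induction on [s]: applying [J - c j] to the relation kills the head term and multiplies every
    other [f i] by [c i - c j], which is nonzero because the eigenvalues are distinct. The rescaled
    vectors are still eigenvectors, so the induction hypothesis applies to them. *)
Lemma eigenvectors_free (K : fieldType) (W : lmodType K) (J : W -> W)
    (I : eqType) (s : seq I) (c : I -> K) (f : I -> W) : linear J ->
  (forall i, i \in s -> J (f i) = c i *: f i) -> uniq [seq c i | i <- s] ->
  \sum_(i <- s) f i = 0 -> forall i, i \in s -> f i = 0.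
Proof.
move=> Jlin; elim: s f => [//|j s IHs] f eigs /= /andP[cj us].
rewrite big_cons => sum0.
have shift0 : \sum_(i <- s) (c i - c j) *: f i = 0.
  have -> : \sum_(i <- s) (c i - c j) *: f i =
      J (\sum_(i <- s) f i) - c j *: \sum_(i <- s) f i.
    rewrite (lin_sum Jlin) scaler_sumr -sumrB.
    rewrite [LHS]big_seq [RHS]big_seq.
    by apply: eq_bigr => i si; rewrite scalerBl eigs ?in_cons ?si ?orbT.
  have -> : \sum_(i <- s) f i = - f j by apply/eqP; rewrite -addr_eq0 addrC sum0.
  by rewrite (lin_opp Jlin) eigs ?mem_head // scalerN subrr.
have s0 i : i \in s -> f i = 0.
  move=> si; have eigs' k : k \in s ->
      J ((c k - c j) *: f k) = c k *: ((c k - c j) *: f k).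
    move=> sk; rewrite (lin_scale Jlin) eigs ?in_cons ?sk ?orbT //.
    by rewrite !scalerA mulrC.
  have /eqP := IHs _ eigs' us shift0 i si.
  rewrite scaler_eq0 subr_eq0 => /orP[/eqP cij|/eqP//].
  by move: cj; rewrite -cij map_f.
move=> i; rewrite in_cons => /predU1P[->|/s0//].
by move: sum0; rewrite big_seq big1 ?addr0.
Qed.

(** The quotient map from the universal calculus is onto, so every form is a sum of images of
    products [a m_1 ... m_n] with each [m_i] of degree one. The product case provides the degrees of
    both factors because the graded Leibniz rule and the sign in [star (x * y)] depend on them. *)
Lemma calculus_ind (K : comNzRingType) (A W : algType K) (iota : A -> W)
    (deg : nat -> set W) (d : W -> W) :
  is_differential_calculus iota deg d -> forall P : W -> Prop,
  (forall a, P (iota a)) -> (forall x, deg 1%N x -> P x) ->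
  (forall x y, P x -> P y -> P (x + y)) ->
  (forall m n x y, deg m x -> deg n y -> P x -> P y -> P (x * y)) ->
  forall x, P x.
Proof.
move=> [_ [I [phi [_ _ phi_surj _ degE _ phi_base]]]] P Piota P1 PD PM x.
have phi_deg n u : univ_deg n u -> deg n (phi u) by move=> hu; apply/degE; exists u.
have P0 : P 0.
  by have := Piota 0; rewrite -phi_base [univ_base 0]/(0 : Omega_univ A) linear0.
have Pvec m : P (phi (univ_vec m)) by apply/P1/phi_deg/univ_deg_vec.
have univ_deg_prod (s : seq (Omega1_univ A)) :
    univ_deg (size s) (\prod_(m <- s) univ_vec m).
  by have := univ_deg_mono 1 s; rewrite [univ_base 1]/(1 : Omega_univ A) mul1r.
have Pprod (s : seq (Omega1_univ A)) : P (phi (\prod_(m <- s) univ_vec m)).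
  elim: s => [|m s IHs]; first by rewrite big_nil -[1]/(univ_base 1) phi_base.
  rewrite big_cons rmorphM; apply: (PM 1%N (size s)) => //.
    exact/phi_deg/univ_deg_vec.
    exact/phi_deg/univ_deg_prod.
  exact: Pvec.
have [u <-] := phi_surj x; elim/Omega_univ_ind: u => [|u v Pu Pv|n u [s ->]].
- by rewrite linear0.
- by rewrite linearD; exact: PD.
rewrite linear_sum; apply: big_ind => // -[a t] _.
rewrite rmorphM; apply: (PM 0%N (size t)) => //.
- exact/phi_deg/univ_deg_base.
- exact/phi_deg/univ_deg_prod.
- by have := Piota a; rewrite -phi_base.
- exact: Pprod.
Qed.

Lemma deg_iota (K : comNzRingType) (A W : algType K) (iota : A -> W)
    (deg : nat -> set W) (d : W -> W) :
  is_differential_calculus iota deg d -> forall a, deg 0%N (iota a).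
Proof.
move=> [_ [I [phi [_ _ _ _ degE _ phi_base]]]] a; apply/degE.
by exists (univ_base a); [exact: univ_deg_base|exact: phi_base].
Qed.

(** * Commutators with a degree-zero derivation *)

Section Bracket.
Variables (K : comNzRingType) (W : algType K) (deg : nat -> set W).
Variable J : W -> W.
Hypothesis J_linear : linear J.
Hypothesis J_deg : forall n x, deg n x -> deg n (J x).
Hypothesis J_derivation : forall x y, J (x * y) = J x * y + x * J y.

Definition bracket (F : W -> W) (x : W) : W := J (F x) - F (J x).

Definition graded_leibniz (F : W -> W) : Prop := forall n x y, deg n x ->
  F (x * y) = F x * y + (-1) ^+ n * (x * F y).

Lemma bracket_linear F : linear F -> linear (bracket F).
Proof.
move=> lF c x y; rewrite /bracket lF !J_linear lF scalerBr.
by rewrite opprD addrACA.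
Qed.

(** The mixed terms [F x * J y] and [(-1) ^+ n * (J x * F y)] occur in both [J (F (x * y))] and
    [F (J (x * y))], hence cancel; since [J] preserves degree, [J x] carries the same sign as
    [x]. *)
Lemma bracket_leibniz F :
  linear F -> graded_leibniz F -> graded_leibniz (bracket F).
Proof.
move=> lF leibF n x y nx; rewrite /bracket J_derivation (lin_add lF).
rewrite (leibF _ _ y nx) (leibF _ _ (J y) nx) (leibF _ _ y (J_deg nx)).
rewrite (lin_add J_linear) (lin_sign J_linear) !J_derivation.
rewrite [in LHS]addrACA mulrBl !mulrDr mulrN.
rewrite [_ + (_ * (J x * F y) + _)]addrCA.
rewrite [X in X - _]addrC [X in _ - X]addrCA addrKA.
rewrite [X in X - _]addrAC [X in X - _]addrC [X in _ - X]addrAC [X in _ - X]addrC.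
by rewrite opprD addrACA subrr add0r opprD addrACA mulrN.
Qed.

End Bracket.

(** * Bidegrees: directness, projections and additive extension *)

Section Bidegree.
Variables (R : realType) (Omega : algType R[i]).
Local Notation C := R[i].
Variables (deg : nat -> set Omega) (J : Omega -> Omega).
Hypothesis deg_grading : is_grading deg.
Hypothesis J_linear : linear J.

Lemma bidegZ p q (c : C) x : bideg deg J p q x -> bideg deg J p q (c *: x).
Proof.
move=> [nx Jx]; split.
  by rewrite -[_ *: _]addr0; apply: grading_lin => //; exact: grading_0.
by rewrite (lin_scale J_linear) Jx !scalerA mulrC.
Qed.

Lemma bidegD p q x y :
  bideg deg J p q x -> bideg deg J p q y -> bideg deg J p q (x + y).
Proof.
move=> [nx Jx] [ny Jy]; split; first by rewrite -[x]scale1r; exact: grading_lin.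
by rewrite (lin_add J_linear) Jx Jy scalerDr.
Qed.

Lemma bideg0 p q : bideg deg J p q 0.
Proof. by split; [exact: grading_0|rewrite (lin_0 J_linear) scaler0]. Qed.

Lemma bidegB p q x y :
  bideg deg J p q x -> bideg deg J p q y -> bideg deg J p q (x - y).
Proof. by move=> hx hy; rewrite -scaleN1r; apply: bidegD => //; exact: bidegZ. Qed.

Lemma bideg_direct n (f : nat -> Omega) :
  (forall k, (k <= n)%N -> bideg deg J k (n - k) (f k)) ->
  \sum_(k < n.+1) f k = 0 -> forall k, (k <= n)%N -> f k = 0.
Proof.
move=> hf; rewrite -(big_mkord xpredT f) /index_iota subn0 => sum0 k kn.
apply: (@eigenvectors_free _ _ J _ (iota 0 n.+1)
    (fun k => (k%:R - (n - k)%:R) * 'i%C) f) => //; last by rewrite mem_iota.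
  by move=> j; rewrite mem_iota => jn; exact: (hf j jn).2.
rewrite map_inj_in_uniq ?iota_uniq // => a b; rewrite !mem_iota !add0n /= !ltnS.
move=> an bn; have i_neq0 : 'i%C != 0 :> C.
  by rewrite eq_complex /= oner_eq0 andbF.
(* The eigenvalue on type [(k, n - k)] is [(2k - n) i], so equal eigenvalues give
   [a + a = b + b]. *)
move/(mulIf i_neq0); rewrite !natrB // !opprB !addrA => /addIr.
rewrite -!natrD => /eqP; rewrite eqr_nat !addnn => /eqP; exact: double_inj.
Qed.

(** [bideg_proj] picks a value by [xget]; directness makes the [p]-th component of any decomposition
    unique, so the choice is forced. *)
Lemma bideg_proj_sum p q (f : nat -> Omega) :
  (forall k, (k <= p + q)%N -> bideg deg J k (p + q - k) (f k)) ->
  bideg_proj deg J p q (\sum_(k < (p + q).+1) f k) = f p.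
Proof.
move=> hf; apply: xget_unique; first by exists f.
move=> _ [g [hg Eg ->]]; apply/eqP; rewrite -subr_eq0; apply/eqP.
apply: (@bideg_direct (p + q) (fun k => g k - f k)); last exact: leq_addr.
  by move=> k kn; apply: bidegB; [exact: hg|exact: hf].
by rewrite sumrB -Eg subrr.
Qed.

(** Meant for [y + z = d x] with [x] of type [(p, q)], once [d x] is known to have only these two
    components. *)
Lemma bideg_proj_pair p q y z :
  bideg deg J p.+1 q y -> bideg deg J p q.+1 z ->
  bideg_proj deg J p.+1 q (y + z) = y /\ bideg_proj deg J p q.+1 (y + z) = z.
Proof.
move=> hy hz.
pose f k := if k == p.+1 then y else if k == p then z else 0.
have fp : f p = z by rewrite /f eqxx ltn_eqF.
have fp1 : f p.+1 = y by rewrite /f eqxx.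
have hf k : (k <= p.+1 + q)%N -> bideg deg J k (p.+1 + q - k) (f k).
  move=> _; rewrite /f; case: eqP => [->|_]; first by rewrite addKn.
  case: eqP => [->|_]; last exact: bideg0.
  by rewrite addSnnS addKn.
have fE : y + z = \sum_(k < (p.+1 + q).+1) f k.
  have lt1 : (p.+1 < (p.+1 + q).+1)%N by rewrite ltnS leq_addr.
  have lt0 : (p < (p.+1 + q).+1)%N by apply: leq_trans lt1.
  rewrite (bigD1 (Ordinal lt1)) //= (bigD1 (Ordinal lt0)) /=; last first.
    by rewrite -val_eqE /= ltn_eqF.
  rewrite fp fp1 big1 ?addr0 // => k /andP[]; rewrite -!val_eqE /= /f.
  by move=> /negbTE-> /negbTE->.
split; first by rewrite fE bideg_proj_sum.
(* The total degree reads [p + q.+1] here and [p.+1 + q] above; [addSnnS] lets the same family [f]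
   serve both projections. *)
by rewrite -[RHS]fp -(@bideg_proj_sum p q.+1 f) -addSnnS // fE.
Qed.

(* Since G is additive, its value does not depend on the decomposition of x. *)
Lemma bideg_extendE (F : nat -> nat -> Omega -> Omega) (G : Omega -> Omega) :
  linear G -> (forall p q x, bideg deg J p q x -> F p q x = G x) ->
  forall x, (exists N (f : nat -> nat -> Omega),
    (forall p q, bideg deg J p q (f p q)) /\
    x = \sum_(p < N) \sum_(q < N) f p q) ->
  bideg_extend deg J F x = G x.
Proof.
move=> Glin FG x [N [f [hf xE]]].
have GE M (g : nat -> nat -> Omega) : (forall p q, bideg deg J p q (g p q)) ->
    \sum_(p < M) \sum_(q < M) F p q (g p q) =
    G (\sum_(p < M) \sum_(q < M) g p q).
  move=> hg; rewrite (lin_sum Glin); apply: eq_bigr => p _.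
  by rewrite (lin_sum Glin); apply: eq_bigr => q _; exact: FG.
apply: xget_unique; first by exists N, f; rewrite GE // -xE.
by move=> _ [M [g [hg Eg ->]]]; rewrite GE // -Eg.
Qed.

(** Lists of forms tagged by type are easy to concatenate and multiply, whereas [bideg_extend]
    requires a square double sum. Grouping the list by tag passes from the first to the second. *)
Lemma bideg_sum_seq (s : seq (nat * nat * Omega)) :
  (forall t, t \in s -> bideg deg J t.1.1 t.1.2 t.2) ->
  exists N (f : nat -> nat -> Omega),
    (forall p q, bideg deg J p q (f p q)) /\
    \sum_(t <- s) t.2 = \sum_(p < N) \sum_(q < N) f p q.
Proof.
move=> hs.
pose F (t : nat * nat * Omega) := (t.1.1 + t.1.2).+1.
pose N := (\max_(t <- s) F t)%N.
exists N, (fun p q => \sum_(t <- s | t.1 == (p, q)) t.2); split=> [p q|].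
  rewrite big_seq_cond; apply: big_ind => [||t /andP[ts /eqP tE]].
  - exact: bideg0.
  - by move=> x y; exact: bidegD.
  - by have := hs t ts; rewrite tE.
(* After the list sum is moved outside, each entry contributes only at its own tag, which lies below
   [N] in both coordinates. *)
under [RHS]eq_bigr do under eq_bigr do rewrite big_mkcond.
under [RHS]eq_bigr do rewrite exchange_big.
rewrite exchange_big /= [LHS]big_seq [RHS]big_seq; apply: eq_bigr => -[[p q] x] ts.
have ltN : (p + q < N)%N := leq_bigmax_seq (P := xpredT) (F := F) _ ts isT.
have pN : (p < N)%N by apply: leq_trans ltN; rewrite ltnS leq_addr.
have qN : (q < N)%N by apply: leq_trans ltN; rewrite ltnS leq_addl.
rewrite (bigD1 (Ordinal pN)) //= (bigD1 (Ordinal qN)) //= eqxx.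
rewrite !big1 ?addr0 // => [i ip|i iq]; last first.
  by rewrite xpair_eqE eqxx eq_sym -val_eqE in iq *; rewrite (negbTE iq).
rewrite big1 // => j _; rewrite xpair_eqE eq_sym -val_eqE in ip *.
by rewrite (negbTE ip).
Qed.

End Bidegree.

(** * Conjugation and the types of one-forms *)

Section AlmostComplexCalculus.
Variables (R : realType) (A Omega : algType R[i]) (starA : A -> A).
Variables (iota : A -> Omega) (deg : nat -> set Omega).
Variables (d star J : Omega -> Omega).
Local Notation C := R[i].
Local Notation B := (bideg deg J).
Hypothesis star_calculus : is_star_calculus starA iota deg d star.
Hypothesis J_complex : is_almost_complex iota deg star J.

Let calc : is_differential_calculus iota deg d := sc_calculus star_calculus.
Let deg_grading : is_grading deg := calc.1.1.
Let d_linear : linear d := diff_linear calc.1.2.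
Let J_linear : linear J := ac_linear J_complex.

Let sqr_i : 'i%C * 'i%C = -1 :> C.
Proof. by rewrite -expr2 sqr_i. Qed.

(** Compatibility is assumed on one-forms only and propagates to products: [star] reverses the
    factors with a sign fixed by their degrees, which the derivation [J] preserves. *)
Lemma J_star x : J (star x) = star (J x).
Proof.
have starD := sc_starD star_calculus; have starM := sc_mul star_calculus.
have star0 : star 0 = 0 by apply: (@addrI _ (star 0)); rewrite -starD !addr0.
elim/(calculus_ind calc): x => [a|x x1|x y Jx Jy|m n x y hx hy Jx Jy].
- by rewrite (sc_iota star_calculus) !(ac_base J_complex) star0.
- exact: (ac_star J_complex).
- by rewrite starD !(lin_add J_linear) starD Jx Jy.
have J_deg := ac_deg J_complex.
rewrite (starM _ _ _ _ hx hy) (lin_sign J_linear).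
rewrite !(ac_derivation J_complex) starD.
rewrite (starM _ _ _ _ (J_deg _ _ hx) hy) (starM _ _ _ _ hx (J_deg _ _ hy)).
by rewrite Jx Jy -mulrDr addrC.
Qed.

Lemma bideg_star p q x : B p q x -> B q p (star x).
Proof.
move=> [hx Jx]; split; first by rewrite addnC; exact: (sc_deg star_calculus).
rewrite J_star Jx (sc_starZ star_calculus); congr (_ *: _).
have conj_i : conjc 'i%C = - 'i%C :> C.
  by apply/eqP; rewrite eq_complex /= oppr0 !eqxx.
by rewrite rmorphM rmorphB !rmorph_nat [X in _ * X]conj_i; ring.
Qed.

Lemma one_form_bideg x : deg 1%N x ->
  exists y z, [/\ B 1 0 y, B 0 1 z & x = y + z].
Proof.
move=> x1; have Jx1 := ac_deg J_complex x1.
(* For [e = i] and [e = -i] this is the projection onto the [e]-eigenspace of [J]; the two halves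
   add up to [x]. *)
have half (e : C) : e * e = -1 -> let y := 2^-1 *: (x - e *: J x) in
    deg 1%N y /\ J y = e *: y.
  move=> ee; split.
    rewrite -[_ *: _]addr0; apply: (grading_lin deg_grading).
      by rewrite addrC -scaleNr; exact: (grading_lin deg_grading).
    exact: (grading_0 deg_grading).
  rewrite (lin_scale J_linear) (lin_sub J_linear) (lin_scale J_linear).
  rewrite (ac_sq J_complex) // scalerN opprK !scalerA mulrC -scalerA.
  by congr (_ *: _); rewrite scalerBr scalerA ee scaleN1r opprK addrC.
have [y1 Jy] := half 'i%C sqr_i.
have [z1 Jz] : _ := half (- 'i%C) (etrans (mulrNN _ _) sqr_i).
eexists; eexists; split.
- by split; [exact: y1|rewrite subr0 mul1r; exact: Jy].
- by split; [exact: z1|rewrite sub0r mulN1r; exact: Jz].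
rewrite -scalerDr scaleNr opprK addrACA addNr addr0 -mulr2n.
by rewrite -[x *+ 2]scaler_nat scalerA mulVf ?scale1r // pnatr_eq0.
Qed.

(** * Integrability, the double commutator of [J] with [d], and the eigencomponents of [d] *)

Hypothesis J_integrable : integrable deg d J.

(** [J] acts on the two components of [d y] as [2i] and [0], both roots of [t^2 = 2i t]. *)
Lemma J_sq_d_10 y : B 1 0 y -> J (J (d y)) = (2 * 'i%C) *: J (d y).
Proof.
move=> /J_integrable[a [b [[_ Ja] [_ Jb] ->]]].
move: Ja Jb; rewrite subr0 subrr mul0r scale0r => Ja Jb.
by rewrite !(lin_add J_linear) Jb (lin_0 J_linear) !addr0 Ja (lin_scale J_linear) Ja.
Qed.

(** Integrability is applied to [star z], of type [(1,0)]; conjugating back puts [d z] in types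
    [(0,2)] and [(1,1)], where [J] is [-2i] and [0]. *)
Lemma J_sq_d_01 z : B 0 1 z -> J (J (d z)) = - (2 * 'i%C) *: J (d z).
Proof.
move=> /bideg_star/J_integrable[a [b [/bideg_star[_ Ja] /bideg_star[_ Jb]]]].
rewrite -(sc_diff star_calculus) => /(congr1 star).
rewrite (sc_starK star_calculus) (sc_starD star_calculus) => ->.
move: Ja Jb; rewrite sub0r subrr mul0r scale0r => Ja Jb.
rewrite !(lin_add J_linear) Jb (lin_0 J_linear) !addr0 Ja (lin_scale J_linear) Ja.
by rewrite mulNr.
Qed.

Let dJ := bracket J d.

Lemma bracket_bracket_d x : bracket J dJ x = - d x.
Proof.
have dJ_linear := bracket_linear J_linear d_linear : linear dJ.
have J_deg := ac_deg J_complex; have J_der := ac_derivation J_complex.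
have dleib : graded_leibniz deg d := diff_leibniz calc.1.2.
have dJleib : graded_leibniz deg dJ by exact: bracket_leibniz.
have ddJleib : graded_leibniz deg (bracket J dJ) by exact: bracket_leibniz.
have ddJ_linear := bracket_linear J_linear dJ_linear.
have bracket2E u : bracket J dJ u =
    J (J (d u)) - J (d (J u)) *+ 2 + d (J (J u)).
  rewrite /bracket /dJ /bracket (lin_sub J_linear) opprB mulr2n opprD.
  by rewrite !addrA [LHS]addrAC.
(* On an eigenvector the expansion becomes [J^2 d u - 2e J d u + e^2 d u]; the first two terms
   cancel and [e^2 = -1]. *)
have on_eigen u (e : C) : e * e = -1 -> J u = e *: u ->
    J (J (d u)) = (2 * e) *: J (d u) -> bracket J dJ u = - d u.
  move=> ee Ju JJdu; rewrite bracket2E JJdu Ju !(lin_scale J_linear) Ju scalerA.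
  rewrite !(lin_scale d_linear) !(lin_scale J_linear) ee scaleN1r.
  by rewrite scalerMnl -[e *+ 2]mulr_natl subrr add0r.
elim/(calculus_ind calc): x => [a|x x1|x y Ex Ey|m n x y hx hy Ex Ey].
(* On [A] only [J (J (d a))] survives, and it equals [- d a] because [d a] is a one-form. *)
- rewrite bracket2E (ac_base J_complex) !(lin_0 J_linear, lin_0 d_linear).
  rewrite mul0rn subr0 addr0 (ac_sq J_complex) //.
  exact/(diff_deg calc.1.2)/(deg_iota calc).
- have [y [z [y10 z01 ->]]] := one_form_bideg x1.
  rewrite (lin_add ddJ_linear) (lin_add d_linear) opprD; congr (_ + _).
    apply: (on_eigen y 'i%C) => //; last exact: J_sq_d_10.
    by rewrite (y10.2) subr0 mul1r.
  apply: (on_eigen z (- 'i%C)); first by rewrite mulrNN.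
    by rewrite (z01.2) sub0r mulN1r.
  by rewrite J_sq_d_01 // mulrN.
- by rewrite (lin_add ddJ_linear) (lin_add d_linear) Ex Ey opprD.
rewrite (ddJleib _ _ _ hx) (dleib _ _ _ hx) Ex Ey opprD.
by rewrite mulNr !mulrN.
Qed.

(** As [[J, -]] squares to [-1] on [d], this is the component of [d] with eigenvalue [e] under
    [[J, -]] when [e * e = -1], by the same formula as for one-forms. *)
Definition dpart (e : C) (x : Omega) : Omega := 2^-1 *: (d x - e *: dJ x).

Lemma dpart_linear e : linear (dpart e).
Proof.
have dJ_linear := bracket_linear J_linear d_linear : linear dJ.
move=> c x y; rewrite /dpart d_linear dJ_linear.
rewrite [e *: (_ + _)]scalerDr [e *: (c *: _)]scalerA [e * c]mulrC.
by rewrite -scalerA opprD addrACA -scalerBr scalerDr !scalerA [_ * c]mulrC.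
Qed.

Lemma dpart_deg e n x : deg n x -> deg n.+1 (dpart e x).
Proof.
have degZ c m y : deg m y -> deg m (c *: y).
  move=> my; rewrite -[_ *: _]addr0; apply: (grading_lin deg_grading) => //.
  exact: (grading_0 deg_grading).
have d_deg := diff_deg calc.1.2; have J_deg := ac_deg J_complex.
have degD := grading_lin deg_grading.
move=> nx; apply: (degZ); rewrite addrC -scaleNr; apply: (degD); last exact: d_deg.
rewrite /dJ /bracket addrC -scaleN1r; apply: (degD); first exact/d_deg/J_deg.
exact/J_deg/d_deg.
Qed.

Lemma dpart_sum x : dpart 'i%C x + dpart (- 'i%C) x = d x.
Proof.
rewrite -scalerDr scaleNr opprK addrACA addNr addr0 -mulr2n -[d x *+ 2]scaler_nat.
by rewrite scalerA mulVf ?scale1r // pnatr_eq0.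
Qed.

(** [[J, d - e [J, d]] = [J, d] + e d = e (d - e [J, d])], using [- e^2 = 1]. *)
Lemma J_dpart e x : e * e = -1 ->
  J (dpart e x) = dpart e (J x) + e *: dpart e x.
Proof.
move=> ee; have JdJ : J (dJ x) = dJ (J x) - d x.
  by rewrite -(bracket_bracket_d x) /bracket [RHS]addrC subrK.
have Jd : J (d x) = dJ x + d (J x) by rewrite /dJ /bracket subrK.
rewrite /dpart (lin_scale J_linear) (lin_sub J_linear) (lin_scale J_linear) Jd JdJ.
rewrite [e *: (_ *: _)]scalerA mulrC -scalerA -scalerDr; congr (_ *: _).
move: (dJ x) (dJ (J x)) (d x) (d (J x)) => a b u v.
rewrite !scalerBr [e *: (e *: _)]scalerA ee scaleN1r !opprK opprB.
by rewrite [a + v]addrC addrACA [RHS]addrACA [a - _]addrC.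
Qed.

(** The degree rises by one while the eigenvalue of [J] moves by [i] or [-i]; these two data
    determine the type. *)
Lemma dpart_bideg p q x : B p q x ->
  B p.+1 q (dpart 'i%C x) /\ B p q.+1 (dpart (- 'i%C) x).
Proof.
move=> [hx Jx]; split; split; rewrite ?addnS ?addSn; try exact: dpart_deg.
  rewrite J_dpart // Jx (lin_scale (dpart_linear _)) -scalerDl.
  by congr (_ *: _); ring.
rewrite J_dpart ?mulrNN // Jx (lin_scale (dpart_linear _)) -scalerDl.
by congr (_ *: _); ring.
Qed.

(** [A] has type [(0,0)], one-forms split, and types add under products because [J] is a
    derivation. *)
Lemma bideg_decomposition x : exists s : seq (nat * nat * Omega),
  (forall t, t \in s -> B t.1.1 t.1.2 t.2) /\ x = \sum_(t <- s) t.2.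
Proof.
elim/(calculus_ind calc): x => [a|x x1|_ _ [s [hs ->]] [t [ht ->]]|
    m n _ _ _ _ [s [hs ->]] [t [ht ->]]].
- exists [:: (0%N, 0%N, iota a)]; rewrite big_seq1; split=> // u.
  rewrite inE => /eqP -> /=; split; first exact: (deg_iota calc).
  by rewrite (ac_base J_complex) subrr mul0r scale0r.
- have [y [z [hy hz ->]]] := one_form_bideg x1.
  exists [:: (1%N, 0%N, y); (0%N, 1%N, z)]; rewrite big_cons big_seq1; split=> // u.
  by rewrite !inE => /orP[]/eqP->.
- exists (s ++ t); rewrite big_cat; split=> // u.
  by rewrite mem_cat => /orP[/hs|/ht].
exists [seq ((u.1.1 + v.1.1)%N, (u.1.2 + v.1.2)%N, u.2 * v.2) | u <- s, v <- t].
rewrite big_allpairs_dep; split; last first.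
  by rewrite mulr_suml; apply: eq_bigr => u _; rewrite mulr_sumr.
move=> _ /allpairsP[[u v] /= [/hs[hu Ju] /ht[hv Jv] ->]]; split=> /=.
  by rewrite addnACA; exact: (grading_mul deg_grading).
rewrite (ac_derivation J_complex) Ju Jv -scalerAl -scalerAr -scalerDl.
by congr (_ *: _); ring.
Qed.

Lemma bideg_vanish (G : Omega -> Omega) : linear G ->
  (forall p q x, B p q x -> G x = 0) -> forall x, G x = 0.
Proof.
move=> lG G0 x; have [s [hs ->]] := bideg_decomposition x.
by rewrite (lin_sum lG) big_seq big1 // => t /hs/G0.
Qed.

(** On type [(p, q)], [d y] is the sum of its two [dpart] components, of types [(p+1, q)] and
    [(p, q+1)], so the projection defining [del] returns the first. Linearity of [dpart] then
    handles the additive extension. *)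
Lemma delE x : del deg d J x = dpart 'i%C x.
Proof.
apply: (bideg_extendE (dpart_linear _)) => [p q y /dpart_bideg[hy hy']|].
  by rewrite -(dpart_sum y) (bideg_proj_pair deg_grading J_linear hy hy').1.
by have [s [hs ->]] := bideg_decomposition x; exact: bideg_sum_seq.
Qed.

Lemma delbarE x : delbar deg d J x = dpart (- 'i%C) x.
Proof.
apply: (bideg_extendE (dpart_linear _)) => [p q y /dpart_bideg[hy hy']|].
  by rewrite -(dpart_sum y) (bideg_proj_pair deg_grading J_linear hy hy').2.
by have [s [hs ->]] := bideg_decomposition x; exact: bideg_sum_seq.
Qed.

(** * The components of [d^2 = 0] and the conclusion *)

Local Notation P := (dpart 'i%C).
Local Notation Q := (dpart (- 'i%C)).

Lemma dpart_sq_bideg p q x : B p q x ->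
  [/\ P (P x) = 0, P (Q x) + Q (P x) = 0 & Q (Q x) = 0].
Proof.
move=> hx; have [hP hQ] := dpart_bideg hx.
have [[_ JPP] hQP] := dpart_bideg hP; have [hPQ [_ JQQ]] := dpart_bideg hQ.
have [_ JPQ] := bidegD deg_grading J_linear hPQ hQP.
(* [c 0], [c 1], [c 2] are the eigenvalues on types [(p+2, q)], [(p+1, q+1)], [(p, q+2)]; they lie
   in steps of [2i], hence are distinct. *)
pose c (k : nat) : C := (p%:R - q%:R) * 'i%C + (1 - k%:R) * (2 * 'i%C).
pose f := nth 0 [:: P (P x); P (Q x) + Q (P x); Q (Q x)].
have f0 : forall k, k \in [:: 0; 1; 2]%N -> f k = 0.
  apply: (eigenvectors_free (c := c) J_linear).
  - move=> k; rewrite !inE => /or3P[]/eqP-> /=.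
    + by rewrite JPP; congr (_ *: _); rewrite /c; ring.
    + by rewrite JPQ; congr (_ *: _); rewrite /c; ring.
    + by rewrite JQQ; congr (_ *: _); rewrite /c; ring.
  - rewrite map_inj_uniq // => j k /addrI /mulIf.
    have -> : 2 * 'i%C != 0 :> C.
      by rewrite mulf_neq0 ?pnatr_eq0 // eq_complex /= oner_eq0 andbF.
    by move=> /(_ isT)/addrI/oppr_inj/eqP; rewrite eqr_nat => /eqP.
  (* The sum of the three terms is [d (d x)], with both copies of [d] expanded as [P + Q]. *)
  - rewrite !big_cons big_nil addr0 /f /= -(diff_sq0 calc.1.2 x).
    rewrite -[in RHS](dpart_sum x) (lin_add d_linear) -!dpart_sum.
    by rewrite -!addrA [X in _ + X = _]addrCA.
by split; [exact: (f0 0%N)|exact: (f0 1%N)|exact: (f0 2%N)].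
Qed.

End AlmostComplexCalculus.

Unset Implicit Arguments.

Theorem proposition3p6 (R : realType)
    (A : algType R[i]) (starA : A -> A)
    (Omega : algType R[i]) (iota : A -> Omega) (deg : nat -> set Omega)
    (d : Omega -> Omega) (star : Omega -> Omega) (J : Omega -> Omega)
    (starA_algebra : is_star_algebra starA)
    (star_calculus : is_star_calculus starA iota deg d star)
    (J_complex : is_almost_complex iota deg star J)
    (J_integrable : integrable deg d J) :
  [/\ forall x, d x = del deg d J x + delbar deg d J x,
      forall x, del deg d J (del deg d J x) = 0,
      forall x, del deg d J (delbar deg d J x)
                + delbar deg d J (del deg d J x) = 0 &
      forall x, delbar deg d J (delbar deg d J x) = 0].
Proof.
have delE' := delE star_calculus J_complex J_integrable.
have delbarE' := delbarE star_calculus J_complex J_integrable.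
have lin := dpart_linear star_calculus J_complex.
have vanish := bideg_vanish star_calculus J_complex.
have sq := dpart_sq_bideg star_calculus J_complex J_integrable.
(* Each quadratic identity now states that a linear map vanishes, which need only be checked on
   forms of pure type. *)
split=> x; rewrite !(delE', delbarE').
- by rewrite dpart_sum.
- apply: (vanish (fun x => dpart d J 'i%C (dpart d J 'i%C x))).
    by move=> c y z; rewrite !lin.
  by move=> p q y /sq[].
- apply: (vanish (fun x => dpart d J 'i%C (dpart d J (- 'i%C) x) +
                           dpart d J (- 'i%C) (dpart d J 'i%C x))).
    by move=> c y z; rewrite !lin scalerDr addrACA.
  by move=> p q y /sq[].
- apply: (vanish (fun x => dpart d J (- 'i%C) (dpart d J (- 'i%C) x))).
    by move=> c y z; rewrite !lin.
  by move=> p q y /sq[].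
Qed.
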